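(* Let $\Omega\subset\mathbb{R}^d$ be bounded, nonempty and open and let $\gamma:\mathbb{R}^d\times\mathbb{R}^d\to[0,\infty)$ be measurable such that $\int_\Gamma\gamma(z,x)\,dz<\infty$ for a.e. $x\in\Omega$. Let $c\in[0,\infty)$ satisfy $\big(\operatorname*{ess\,inf}_{x\in\Omega}\int_\Gamma\gamma(y,x)\,dy\big)+c>0$, define $w:\Gamma\to(0,\infty]$ by $$w(y)=\int_\Omega\frac{\gamma(y,x)}{\int_\Gamma\gamma(z,x)\,dz+c}\,dx,$$ and set $\mathrm{W}(\Gamma;\gamma):=\{u:\Gamma\to\mathbb{R}\text{ measurable}:\|u\|_{\mathrm{W}(\Gamma;\gamma)}<\infty\}$, where $$\|u\|_{\mathrm{W}(\Gamma;\gamma)}^2:=\int_\Gamma u^2(y)w(y)\,dy+\int_\Gamma\int_\Gamma(u(y)-u(z))^2\int_\Omega\frac{\gamma(y,x)\gamma(z,x)}{\int_\Gamma\gamma(s,x)\,ds+c}\,dx\,dy\,dz.$$ Then: (i) $\operatorname{Tr}:\mathrm{V}(\Omega;\gamma)\to\mathrm{W}(\Gamma;\gamma)$, $\operatorname{Tr}(v)=v|_\Gamma$, is a linear operator and there is a $C>0$ with $\|\operatorname{Tr}(u)\|_{\mathrm{W}(\Gamma;\gamma)}\le C\|u\|_{\mathrm{V}(\Omega;\gamma)}$ for all $u\in\mathrm{V}(\Omega;\gamma)$. (ii) $\operatorname{E}:\mathrm{W}(\Gamma;\gamma)\to L^2(\Omega)$, $$\operatorname{E}(v)=\int_\Gamma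 v(y)\frac{\gamma(y,\cdot)}{\int_\Gamma\gamma(s,\cdot)\,ds+c}\,dy,$$ is a linear operator and there is a $C>0$ with $$\|\operatorname{E}(v)\|_{L^2(\Omega)}^2+\int_\Omega\int_\Gamma(\operatorname{E}(v)(x)-v(y))^2\gamma(y,x)\,dy\,dx\le C\|v\|_{\mathrm{W}(\Gamma;\gamma)}^2\quad\text{for all }v\in\mathrm{W}(\Gamma;\gamma).$$ (iii) If there is a $C>0$ with $$\int_\Omega\int_\Omega(\operatorname{E}(v)(x)-\operatorname{E}(v)(y))^2\gamma(y,x)\,dy\,dx\le C\|v\|_{\mathrm{W}(\Gamma;\gamma)}^2\quad\text{for all }v\in\mathrm{W}(\Gamma;\gamma),$$ then $\operatorname{Tr}$ is surjective.
   Context: Measurability is with respect to Lebesgue measure. Let $\Gamma:=\{y\in\mathbb{R}^d\setminus\Omega:\int_\Omega\gamma(y,x)\,dx>0\}$. $\mathrm{V}(\Omega;\gamma)$ is the space of measurable $v:\mathbb{R}^d\to\mathbb{R}$ with $$\|v\|_{\mathrm{V}(\Omega;\gamma)}^2:=\int_\Omega v^2(x)\,dx+\int_\Omega\int_{\mathbb{R}^d}(v(x)-v(y))^2\gamma(y,x)\,dy\,dx<\infty,$$ functions agreeing a.e. on $\Omega\cup\Gamma$ being identified. Elements of $\mathrm{W}(\Gamma;\gamma)$ are identified if they agree a.e. on $\Gamma$. *)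

(* Defs.v *)
From HB Require Import structures.
From mathcomp Require Import all_boot all_order all_algebra.
From mathcomp Require Import all_classical all_reals all_analysis.

Set Implicit Arguments.
Unset Strict Implicit.
Unset Printing Implicit Defensive.

Import Order.TTheory GRing.Theory Num.Theory.
Import numFieldNormedType.Exports.

Local Open Scope classical_set_scope.
Local Open Scope ring_scope.

(** Lebesgue measure on R^d: the completion (Caratheodory extension) of the
    d-fold product of the one-dimensional Lebesgue measure.  Points of R^d are
    row vectors ['rV[R]_d]. *)

(* R^d with the product of the Borel sigma-algebras of the d coordinates *)
Definition borelRn (R : realType) (d : nat) : Type := 'rV[R]_d.

Definition borelRn_display : measure_display. Proof. exact. Qed.

Section borelRn.
Variables (R : realType) (d : nat).

Let coord (i : 'I_d) (x : 'rV[R]_d) : measurableTypeR R := x ord0 i.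

HB.instance Definition _ := Pointed.copy (borelRn R d) 'rV[R]_d.

Let coord_set0 : g_sigma_preimage coord set0.
Proof. exact: sigma_algebra0. Qed.

Let coord_setC A : g_sigma_preimage coord A -> g_sigma_preimage coord (~` A).
Proof. exact: sigma_algebraC. Qed.

Let coord_bigcup (F : (set _)^nat) : (forall i, g_sigma_preimage coord (F i)) ->
  g_sigma_preimage coord (\bigcup_i (F i)).
Proof. exact: sigma_algebra_bigcup. Qed.

HB.instance Definition _ := @isMeasurable.Build borelRn_display
  (borelRn R d) (g_sigma_preimage coord) coord_set0 coord_setC coord_bigcup.

Lemma measurable_coord (i : 'I_d) :
  measurable_fun [set: borelRn R d]
    (fun x : borelRn R d => (x : 'rV[R]_d) ord0 i).
Proof.
move=> _ Y mY; rewrite setTI; apply: sub_sigma_algebra => /=.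
rewrite -bigcup_seq/=; exists i => /=; first by rewrite mem_index_enum.
by exists Y => //; rewrite setTI.
Qed.

Lemma measurable_fun_coordP d' (T : measurableType d') (f : T -> borelRn R d) :
  (forall i, measurable_fun [set: T] (fun t => (f t : 'rV[R]_d) ord0 i)) ->
  measurable_fun [set: T] f.
Proof.
move=> mf; have : g_sigma_preimage (fun i => coord i \o f) `<=` measurable.
  apply: smallest_sub; first exact: sigma_algebra_measurable.
  rewrite -bigcup_seq; apply: bigcup_sub => i _ A [B mB <-].
  exact: mf.
rewrite g_sigma_preimage_comp => prefS _ A mA.
by apply: prefS; exists A.
Qed.

End borelRn.

Section consRn.
Variables (R : realType) (d : nat).

Definition consRn (p : R * borelRn R d) : borelRn R d.+1 :=
  row_mx (const_mx p.1 : 'rV[R]_1) (p.2 : 'rV[R]_d).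

Definition unconsRn (x : borelRn R d.+1) : R * borelRn R d :=
  ((x : 'rV[R]_d.+1) ord0 ord0, rsubmx (x : 'rV[R]_(1 + d))).

Lemma consRnK : cancel consRn unconsRn.
Proof.
move=> [t v]; rewrite /unconsRn /consRn /=; congr pair; last exact: row_mxKr.
rewrite mxE; case: splitP => [j _|j /eqP]; last by rewrite eq_sym.
by rewrite mxE.
Qed.

Lemma measurable_consRn : measurable_fun [set: R * borelRn R d] consRn.
Proof.
apply: measurable_fun_coordP => i; have [j ij|j ij] := splitP (i : 'I_(1 + d)).
  rewrite (_ : (fun _ => _) = fst); first exact: measurable_fst.
  apply/funext => -[t v] /=.
  have -> : i = lshift d j by exact/val_inj.
  by apply: etrans (@row_mxEl _ 1 1 d _ _ ord0 j) _; rewrite mxE.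
rewrite (_ : (fun _ => _) =
    (fun x : borelRn R d => (x : 'rV[R]_d) ord0 j) \o snd).
  by apply: measurableT_comp; [exact: measurable_coord|exact: measurable_snd].
apply/funext => -[t v] /=.
have -> : i = rshift 1 j by exact/val_inj.
exact: (@row_mxEr _ 1 1 d).
Qed.

Lemma measurable_unconsRn : measurable_fun [set: borelRn R d.+1] unconsRn.
Proof.
apply/measurable_fun_pairP; split.
  exact: measurable_coord.
apply: measurable_fun_coordP => i /=.
rewrite (_ : (fun _ => _) =
    (fun x : borelRn R d.+1 => (x : 'rV[R]_d.+1) ord0 (rshift 1 i))).
  exact: measurable_coord.
by apply/funext => x; rewrite mxE.
Qed.

End consRn.

Section borel_lebesgue_succ.
Local Open Scope ereal_scope.
Variables (R : realType) (d : nat).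
Variable mu : {sigma_finite_measure set (borelRn R d) -> \bar R}.

Definition borel_lebesgue_succ : set (borelRn R d.+1) -> \bar R :=
  pushforward (@lebesgue_measure R \x mu)%E (@consRn R d).

Let succ0 : borel_lebesgue_succ set0 = 0.
Proof. by rewrite /borel_lebesgue_succ/pushforward preimage_set0 measure0. Qed.

Let succ_ge0 A : 0 <= borel_lebesgue_succ A.
Proof. exact: integral_ge0. Qed.

Let measurable_preimage_consRn (A : set (borelRn R d.+1)) :
  measurable A -> measurable (@consRn R d @^-1` A).
Proof.
by move=> mA; rewrite -[X in measurable X]setTI; exact: measurable_consRn.
Qed.

Let succ_sigma_additive : semi_sigma_additive borel_lebesgue_succ.
Proof.
move=> F mF tF mUF; rewrite /borel_lebesgue_succ/pushforward preimage_bigcup.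
apply: measure_semi_sigma_additive.
- by move=> n; exact: measurable_preimage_consRn.
- apply/trivIsetP => /= i j _ _ ij; rewrite -preimage_setI.
  by move/trivIsetP : tF => /(_ _ _ _ _ ij) ->//; rewrite preimage_set0.
- by rewrite -preimage_bigcup; exact: measurable_preimage_consRn.
Qed.

HB.instance Definition _ := isMeasure.Build _ _ _
  borel_lebesgue_succ succ0 succ_ge0 succ_sigma_additive.

Let succ_sigma_finite : sigma_finite setT borel_lebesgue_succ.
Proof.
have /sigma_finiteP[F [TF ndF Foo]] := sigma_finiteT (@lebesgue_measure R).
have /sigma_finiteP[G [TG ndG Goo]] := sigma_finiteT mu.
exists (fun n => @unconsRn R d @^-1` (F n `*` G n)).
  rewrite -preimage_bigcup; apply/esym/seteqP; split=> // x _ /=.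
  have [[n _ Fn] [m _ Gm]] : (\bigcup_n F n) (unconsRn x).1 /\
      (\bigcup_n G n) (unconsRn x).2 by rewrite -TF -TG.
  exists (maxn n m) => //; split.
    by move: Fn; exact/subsetPset/ndF/leq_maxl.
  by move: Gm; exact/subsetPset/ndG/leq_maxr.
move=> n; have [mF Fn] := Foo n; have [mG Gn] := Goo n; split.
  rewrite -[X in measurable X]setTI.
  by apply: measurable_unconsRn => //; exact: measurableX.
rewrite /borel_lebesgue_succ/pushforward -comp_preimage.
rewrite (_ : _ \o _ = id); last exact/funext/consRnK.
by rewrite preimage_id product_measure1E// lte_mul_pinfty// ge0_fin_numE.
Qed.

HB.instance Definition _ := Measure_isSigmaFinite.Build _ _ _
  borel_lebesgue_succ succ_sigma_finite.

End borel_lebesgue_succ.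

(* d-fold product of the Lebesgue measure of R; R^0 is a single point. *)
Fixpoint borel_lebesgue (R : realType) (d : nat) :
    {sigma_finite_measure set (borelRn R d) -> \bar R} :=
  match d with
  | 0%N => @dirac _ (borelRn R 0) (0 : 'rV[R]_0) R
  | d'.+1 => borel_lebesgue_succ (borel_lebesgue R d')
  end.

(* R^d with the sigma-algebra of Lebesgue measurable sets *)
Definition lebesgueRn (R : realType) (d : nat) : measurableType _ :=
  caratheodory_type ((borel_lebesgue R d)^*)%mu.

Definition lebesgue (R : realType) (d : nat) :
    {measure set (lebesgueRn R d) -> \bar R} :=
  @completed_measure_extension _ _ _ (borel_lebesgue R d).

(** Function spaces.  A function on [D] is encoded by a total function of which
    only the values on [D] matter, an element of a quotient space by any of its
    representatives; the identification is kept as an explicit relation. *)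

Section function_spaces.
Variables (R : realType) (d : nat).
Local Notation Rd := 'rV[R]_d.
Local Notation lambda := (lebesgue R d).

Definition lebesgue_measurable_fun (D : set Rd) (f : Rd -> R) : Prop :=
  @measurable_fun _ _ (lebesgueRn R d) R D f.

Definition eq_ae_on (D : set Rd) (f g : Rd -> R) : Prop :=
  \forall x \ae lambda, D x -> f x = g x.

(* the library's [ess_inf], relative to a subset *)
Definition ess_inf_on (D : set Rd) (f : Rd -> \bar R) : \bar R :=
  ereal_sup [set m | \forall x \ae lambda, D x -> (m <= f x)%E].

Definition linear_subspace (X : set (Rd -> R)) : Prop :=
  X (fun=> 0) /\
  forall (a : R) u v, X u -> X v -> X (fun x => a * u x + v x).

(* [A] induces a linear map from [X] modulo [eqX] to [Y] modulo [eqY]. *)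
Definition linear_operator
    (X : set (Rd -> R)) (eqX : (Rd -> R) -> (Rd -> R) -> Prop)
    (Y : set (Rd -> R)) (eqY : (Rd -> R) -> (Rd -> R) -> Prop)
    (A : (Rd -> R) -> (Rd -> R)) : Prop :=
  [/\ linear_subspace X, linear_subspace Y,
      forall u, X u -> Y (A u),
      forall u v, X u -> X v -> eqX u v -> eqY (A u) (A v) &
      forall (a : R) u v, X u -> X v ->
        eqY (A (fun x => a * u x + v x)) (fun x => a * A u x + A v x)].

Definition sqnormL2 (D : set Rd) (f : Rd -> R) : \bar R :=
  (\int[lambda]_(x in D) (f x ^+ 2)%:E)%E.

Definition spaceL2 (D : set Rd) : set (Rd -> R) :=
  [set f | lebesgue_measurable_fun D f /\ (sqnormL2 D f < +oo)%E].

Variables (Omega : set Rd) (gamma : Rd -> Rd -> R).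

Definition Gamma : set Rd :=
  [set y | ~ Omega y /\ (0 < \int[lambda]_(x in Omega) (gamma y x)%:E)%E].

Definition sqnormV (v : Rd -> R) : \bar R :=
  (\int[lambda]_(x in Omega) (v x ^+ 2)%:E +
   \int[lambda]_(x in Omega) \int[lambda]_y
     ((v x - v y) ^+ 2 * gamma y x)%:E)%E.

Definition normV (v : Rd -> R) : \bar R := sqrte (sqnormV v).

Definition spaceV : set (Rd -> R) :=
  [set v | lebesgue_measurable_fun setT v /\ (sqnormV v < +oo)%E].

Definition eqV : (Rd -> R) -> (Rd -> R) -> Prop := eq_ae_on (Omega `|` Gamma).

(* x |-> \int_Gamma gamma(y, x) dy *)
Definition massGamma (x : Rd) : \bar R :=
  (\int[lambda]_(y in Gamma) (gamma y x)%:E)%E.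

Variable c : R.

(* [massGamma] is assumed finite almost everywhere in [Omega], so that [fine]
   discards only a null set. *)
Definition denom (x : Rd) : R := fine (massGamma x) + c.

Definition weight (y : Rd) : \bar R :=
  (\int[lambda]_(x in Omega) (gamma y x / denom x)%:E)%E.

(* The product in the first integral is taken in [\bar R], with 0 * +oo = 0. *)
Definition sqnormW (u : Rd -> R) : \bar R :=
  (\int[lambda]_(y in Gamma) ((u y ^+ 2)%:E * weight y) +
   \int[lambda]_(z in Gamma) \int[lambda]_(y in Gamma)
     (((u y - u z) ^+ 2)%:E *
      \int[lambda]_(x in Omega) (gamma y x * gamma z x / denom x)%:E))%E.

Definition normW (u : Rd -> R) : \bar R := sqrte (sqnormW u).

Definition spaceW : set (Rd -> R) :=
  [set u | lebesgue_measurable_fun Gamma u /\ (sqnormW u < +oo)%E].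

Definition eqW : (Rd -> R) -> (Rd -> R) -> Prop := eq_ae_on Gamma.

(* restriction to [Gamma], extended by 0 *)
Definition Tr (v : Rd -> R) : Rd -> R := v \_ Gamma.

Definition extE (v : Rd -> R) (x : Rd) : R :=
  \int[lambda]_(y in Gamma) (v y * (gamma y x / denom x)).

End function_spaces.

(* Main.v *)
(** Put m(x) = \int_Gamma gamma(y,x) dy, D = m + c and p(y) = gamma(y,x) / D(x),
    so that s = \int_Gamma p <= 1 and D (1 - s) = c.  For fixed x in Omega, with
    e = E(u)(x) = \int_Gamma u p and q = \int_Gamma u^2 p, Tonelli's theorem turns
    the two parts of |u|_W^2 into the integrals over Omega of q and of
    D \int\int (u(y) - u(z))^2 p(y) p(z) = 2 D (q s - e^2).  Everything then is
    quadratic algebra at fixed x: e^2 <= q because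
    0 <= \int (u - e)^2 p = q - (2 - s) e^2; the energy of the extension is
    D (q - 2 e^2 + s e^2) = D (q s - e^2) + c (q - e^2); and the trace estimate
    follows by replacing u with u(x) - u, which leaves q s - e^2 unchanged.

    Since gamma is only Lebesgue measurable on R^(d+d), it is first replaced by
    a kernel k which is measurable for the product sigma-algebra and has almost
    everywhere the same sections: gamma is Borel off a Borel null set N, and
    almost every section of N is null. *)

Require Import Defs.
From HB Require Import structures.
From mathcomp Require Import all_boot all_order all_algebra.
From mathcomp Require Import all_classical all_reals all_analysis.
From mathcomp Require Import measurable_realfun.
From mathcomp Require Import ring lra.
Set Implicit Arguments.
Unset Strict Implicit.
Unset Printing Implicit Defensive.
Import Order.TTheory GRing.Theory Num.Theory.
Import numFieldNormedType.Exports.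
Local Open Scope classical_set_scope.
Local Open Scope ring_scope.

(** * Integrals without measurability *)

(* The library's integral of a nonnegative function is the supremum of the
   integrals of the simple functions below it, measurable or not; it is thus
   monotone and insensitive to null sets even for the sections of [gamma],
   which need not all be measurable. *)
Section lower_integral.
Local Open Scope ereal_scope.
Context d (T : measurableType d) (R : realType).
Variable mu : {measure set T -> \bar R}.
Implicit Types (D : set T) (f g : T -> \bar R).

Import HBNNSimple.

(** For c > 0 the weights p have total mass s < 1. The missing mass 1 - s = c / D acts as an atom at
    which u takes the value 0: with it e is a true mean and q - e^2 a variance, and the term c (q -
    e^2) in the energy of the extension is the contribution of the atom. This is the origin of the
    constant 1 + c in (ii). The trace estimate loses a factor D / a, where a > 0 bounds D from below
    almost everywhere on Omega; the condition on the essential infimum supplies such an a. For (iii)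
    the preimage of u is E(u) on Omega, u on Gamma and 0 elsewhere. The definition of Gamma is what
    makes the value 0 harmless. The exchange of gamma for k takes place under iterated integrals
    whose integrands are not yet known to be measurable, so null sets have to be discarded one
    variable at a time and in both orders of the variables. Gamma keeps its definition through
    gamma; completeness of Lebesgue measure makes it measurable. *)

Lemma ge0_ae_le_integral D f g :
  (forall x, D x -> 0 <= f x) -> (forall x, D x -> 0 <= g x) ->
  (\forall x \ae mu, D x -> f x <= g x) ->
  \int[mu]_(x in D) f x <= \int[mu]_(x in D) g x.
Proof.
move=> f0 g0 [N [mN N0 fgN]].
rewrite !ge0_integralE//= ge_ereal_sup// => _ [h/= hf <-].
have mNC := measurableC mN.
have hE x : proj_nnsfun h mNC x = (h \_ (~` N)) x by rewrite mrestrict.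
(* Cutting [h] off on the null set [N] puts it below [g] everywhere and leaves its integral
   unchanged. *)
apply: ereal_sup_ubound; exists (proj_nnsfun h mNC).
  move=> x; rewrite hE patchE; have [xN|xN] := boolP (x \in ~` N); last first.
    by rewrite patchE; case: ifPn => // xD; exact/g0/set_mem.
  rewrite (le_trans (hf x))// !patchE; case: ifPn => // /set_mem xD.
  by move: xN; rewrite inE => xN; apply: contrapT => fg; apply/xN/fgN => /(_ xD).
rewrite -!integralT_nnsfun; apply: ge0_ae_eq_integral => //.
- by apply/measurable_EFinP.
- by apply/measurable_EFinP.
- by move=> x _; rewrite lee_fin.
- by move=> x _; rewrite lee_fin.
exists N; split => // x /not_implyP[_]; rewrite hE patchE.
by case: (boolP (x \in ~` N)); rewrite ?notin_setE// => /contrapT.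
Qed.

Lemma ge0_le_integral_lower D f g :
  (forall x, D x -> 0 <= f x) -> (forall x, D x -> f x <= g x) ->
  \int[mu]_(x in D) f x <= \int[mu]_(x in D) g x.
Proof.
move=> f0 fg; apply: ge0_ae_le_integral => //; last exact/aeW.
by move=> x Dx; rewrite (le_trans (f0 x Dx))// fg.
Qed.

(** The preceding comparison, in both directions, for the positive and the negative parts. This is
    the tool that replaces [gamma] by [k] inside the iterated integrals of the statement, one
    variable at a time. *)
Lemma ae_eq_integral_lower D f g :
  (\forall x \ae mu, D x -> f x = g x) ->
  \int[mu]_(x in D) f x = \int[mu]_(x in D) g x.
Proof.
move=> fg; rewrite integralE [RHS]integralE.
by congr (_ - _); apply/eqP; rewrite eq_le; apply/andP; split;
  apply: ge0_ae_le_integral => //; apply: filterS fg => x fgx /fgx;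
  rewrite ?funeposE ?funenegE => ->.
Qed.

Lemma ge0_integral_subset D D' f :
  D `<=` D' -> (forall x, D' x -> 0 <= f x) ->
  \int[mu]_(x in D) f x <= \int[mu]_(x in D') f x.
Proof.
move=> DD f0; rewrite integral_mkcond [leRHS]integral_mkcond.
apply: ge0_le_integral_lower => x _; rewrite !patchE.
  by case: ifPn => // /set_mem/DD/f0.
case: ifPn => [/set_mem/DD/mem_set ->//|_].
by case: ifPn => // /set_mem/f0.
Qed.

Lemma ge0_integral_eq0_ae D f :
  measurable D -> measurable_fun [set: T] f -> (forall x, 0 <= f x) ->
  \int[mu]_(x in D) f x = 0 -> \forall x \ae mu, D x -> f x = 0.
Proof.
move=> mD mf f0 if0; have mfD : measurable_fun D f by exact: measurable_funTS.
have [+ _] := ae_eq_integral_abs mu mD mfD.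
by under eq_integral do rewrite gee0_abs//; exact.
Qed.

End lower_integral.

(** * Completed product measures *)

Section completion.
Local Open Scope ereal_scope.
Context d (T : measurableType d) (R : realType).
Variable mu : {measure set T -> \bar R}.
Local Notation muC := (@completed_measure_extension _ _ _ mu).
Local Notation TC := (caratheodory_type (mu^*)%mu).

Lemma measurable_completion (A : set T) :
  measurable A -> measurable (A : set TC).
Proof. by move=> mA; exact: caratheodory_measurable_mu_ext. Qed.

Lemma completed_measureE (A : set T) : measurable A -> muC A = mu A.
Proof. by move=> mA; rewrite /completed_measure_extension measurable_mu_extE. Qed.

Lemma negligible_completion (A : set T) : mu.-negligible A -> muC.-negligible A.
Proof.
move=> [N [mN N0 AN]]; exists N; split => //; first exact: measurable_completion.
by rewrite -N0; exact: completed_measureE.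
Qed.

Lemma ae_completion (P : T -> Prop) :
  (\forall x \ae mu, P x) -> (\forall x \ae muC, P x).
Proof. exact: negligible_completion. Qed.

Lemma measurable_fun_completion d' (U : measurableType d') (f : T -> U) :
  measurable_fun [set: T] f -> measurable_fun [set: TC] f.
Proof.
by move=> mf _ B mB; rewrite setTI -[X in measurable X]setTI;
  apply: measurable_completion; exact: mf.
Qed.

(** On every set [muC] is an infimum over countable measurable covers. [B] is the intersection of
    the unions of covers that come within 1 / (n + 1) of it. *)
Lemma measurable_hull (E : set T) : muC E < +oo ->
  exists B : set T, [/\ measurable B, E `<=` B & mu B = muC E].
Proof.
move=> Eoo.
have Efin : muC E \is a fin_num by rewrite ge0_fin_numE.
have inv0 n : (0 < n.+1%:R^-1 :> R)%R by rewrite invr_gt0.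
have /choice[A AP] n : exists A : (set T)^nat, measurable_cover E A /\
    \sum_(0 <= k <oo) mu (A k) < muC E + n.+1%:R^-1%:E.
  have /lb_ereal_inf_adherent := Efin.
  by move=> /(_ _ (inv0 n))[_/= [A EA] <-] ?; exists A.
pose F n := \bigcup_m A n m.
have mF n : measurable (F n).
  by apply: bigcup_measurable => k _; have [[+ _] _] := AP n; exact.
have muF n : mu (F n) < muC E + n.+1%:R^-1%:E.
  have [[mA _] +] := AP n; apply: le_lt_trans.
  by apply: measure_sigma_subadditive => //; exact: mF.
have EB : E `<=` \bigcap_n F n.
  by apply: sub_bigcap => n _; have [[_ +] _] := AP n.
have mB : measurable (\bigcap_n F n) by exact: bigcapT_measurable.
exists (\bigcap_n F n); split => //.
apply/eqP; rewrite eq_le; apply/andP; split; last first.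
  by rewrite -(completed_measureE mB); exact: le_outer_measure.
apply/lee_addgt0Pr => /= _/posnumP[e]; near \oo => n.
apply: (@le_trans _ _ (mu (F n))).
  by apply: le_measure; rewrite ?inE//; exact: bigcap_inf.
rewrite (le_trans (ltW (muF n)))// leeD// lee_fin ltW//.
by near: n; apply: near_infty_natSinv_lt.
Unshelve. all: by end_near. Qed.

Hypothesis sf : sigma_finite setT mu.

(** For finite measure, [B] is a hull of [E] and [N] a hull of the null set between [E] and [B].
    Sigma-finiteness reduces the general case to this one by cutting [E] into countably many
    pieces. *)
Lemma completion_measurable (E : set TC) : measurable E ->
  exists B N : set T, [/\ measurable B, measurable N, mu N = 0 &
    E `\` N = B `\` N].
Proof.
wlog : E / muC E < +oo.
  move=> H mE; have [F TF Ffin] := sf.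
  have mF n : measurable (F n) by have [] := Ffin n.
  have /choice[B /choice[N BN]] n : exists B N : set T,
      [/\ measurable B, measurable N, mu N = 0 & (E `&` F n) `\` N = B `\` N].
    apply: H; last by apply: measurableI => //; exact: measurable_completion.
    rewrite (@le_lt_trans _ _ (muC (F n)))//.
      by apply: le_outer_measure; exact: subIsetr.
    by rewrite completed_measureE//; have [] := Ffin n.
  exists (\bigcup_n B n), (\bigcup_n N n); split.
  - by apply: bigcupT_measurable => n; have [] := BN n.
  - by apply: bigcupT_measurable => n; have [] := BN n.
  - apply/negligibleP; first by apply: bigcupT_measurable => n; have [] := BN n.
    apply: negligible_bigcup => n; have [_ mN N0 _] := BN n.
    exact/negligibleP.
  - apply/seteqP; split=> x [].
      move=> Ex Nx; split => //.
      have : [set: T] x by [].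
      rewrite TF => -[n _ Fnx]; exists n => //.
      have [_ _ _ eBN] := BN n.
      suff : (B n `\` N n) x by case.
      by rewrite -eBN; split => // Nnx; apply: Nx; exists n.
    move=> [n _ Bnx] Nx; split => //.
    have [_ _ _ eBN] := BN n.
    suff : ((E `&` F n) `\` N n) x by case => -[].
    by rewrite eBN; split => // Nnx; apply: Nx; exists n.
move=> Eoo mE; have [B [mB EB muB]] := measurable_hull Eoo.
have Efin : muC E \is a fin_num by rewrite ge0_fin_numE.
have mB' := measurable_completion mB.
have BE0 : muC (B `\` E) = 0.
  have BEB : B `&` E = E by rewrite setIC; exact/setIidPl.
  rewrite measureD//= ?BEB; last by rewrite completed_measureE// muB.
  by rewrite [X in X - _]completed_measureE// muB subee.
have [|N [mN BEN muN]] := @measurable_hull (B `\` E); first by rewrite BE0.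
exists B, N; split => //; first by rewrite muN.
apply/seteqP; split=> x [].
  by move=> Ex Nx; split => //; exact: EB.
by move=> Bx Nx; split => //; apply: contrapT => Ex; apply/Nx/BEN.
Qed.

(** Countably many sublevel sets, those at rational heights, determine [f]; outside the union of
    their exceptional null sets all of them are measurable for the smaller sigma-algebra. *)
Lemma completion_measurable_fun (f : T -> R) : measurable_fun [set: TC] f ->
  exists N : set T, [/\ measurable N, mu N = 0 &
    measurable_fun [set: T] (f \_ (~` N))].
Proof.
move=> mf.
(* An enumeration of the rationals; an index that codes no rational merely repeats the height 0. *)
pose q n : R := ratr (odflt (0%R : rat) (unpickle n)).
have /choice[B /choice[N BN]] n : exists B N : set T,
    [/\ measurable B, measurable N, mu N = 0 &
      (f @^-1` `]-oo, q n[) `\` N = B `\` N].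
  by apply: completion_measurable; rewrite -[X in measurable X]setTI; exact: mf.
have mN : measurable (\bigcup_n N n).
  by apply: bigcupT_measurable => n; have [] := BN n.
exists (\bigcup_n N n); split => //.
  apply/negligibleP => //; apply: negligible_bigcup => n.
  by have [_ ? ? _] := BN n; exact/negligibleP.
apply/(measurable_restrictT f); first exact: measurableC.
apply: (measurability _ (RGenInftyO.measurableE R)) => _ [_ [r ->] <-].
rewrite (_ : _ `&` _ =
    (\bigcup_(n in [set n | (q n < r)%R]) B n) `\` \bigcup_n N n).
  apply: measurableD => //; apply: bigcup_measurable => n _.
  by have [] := BN n.
apply/seteqP; split => x.
  move=> [Nx]; rewrite /= in_itv/= => /rat_in_itvoo[p].
  rewrite in_itv/= => /andP[fp pr]; split => //.
  have qp : q (pickle p) = ratr p by rewrite /q pickleK.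
  exists (pickle p); first by rewrite /= qp.
  have [_ _ _ eBN] := BN (pickle p).
  suff : (B (pickle p) `\` N (pickle p)) x by case.
  rewrite -eBN; split; first by rewrite /= in_itv/= qp.
  by move=> Npx; apply: Nx; exists (pickle p).
move=> [[n /= qr Bnx] Nx]; split => //; rewrite in_itv/=.
have [_ _ _ eBN] := BN n.
have : (f @^-1` `]-oo, q n[) x.
  suff : ((f @^-1` `]-oo, q n[) `\` N n) x by case.
  by rewrite eBN; split => // Nnx; apply: Nx; exists n.
by rewrite /= in_itv/= => /lt_trans; exact.
Qed.

End completion.

(** * Lebesgue measure on R^(m+n) as a product, and sections of null sets *)

Section lebesgueRn_product.
Local Open Scope ereal_scope.
Variable R : realType.

Lemma lebesgue_complete d : measure_is_complete (lebesgue R d).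
Proof. exact: measure_is_complete_caratheodory. Qed.

Lemma lebesgue_sigma_finite d : sigma_finite setT (lebesgue R d).
Proof. exact/completed_measure_extension_sigma_finite/sigma_finiteT. Qed.

Definition row_mxRn m n (p : borelRn R m * borelRn R n) : borelRn R (m + n) :=
  row_mx (p.1 : 'rV[R]_m) (p.2 : 'rV[R]_n).

Lemma measurable_row_mxRn m n : measurable_fun [set: _ * _] (@row_mxRn m n).
Proof.
apply: measurable_fun_coordP => i; rewrite /row_mxRn.
have [j ij|j ij] := splitP i.
  rewrite (_ : (fun _ => _) = (fun x : borelRn R m => (x : 'rV[R]_m) ord0 j) \o fst).
    by apply: measurableT_comp; [exact: measurable_coord|exact: measurable_fst].
  apply/funext => -[x y] /=.
  by have -> : i = lshift n j by [exact/val_inj]; rewrite row_mxEl.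
rewrite (_ : (fun _ => _) = (fun x : borelRn R n => (x : 'rV[R]_n) ord0 j) \o snd).
  by apply: measurableT_comp; [exact: measurable_coord|exact: measurable_snd].
apply/funext => -[x y] /=.
by have -> : i = rshift m j by [exact/val_inj]; rewrite row_mxEr.
Qed.

(** Used for the induction on [m] below, since [borel_lebesgue] is defined by splitting off the
    first coordinate. Both sides have the same type because [m.+1 + n] reduces to [(m + n).+1]. *)
Lemma row_mx_consRn m n t (x : borelRn R m) (y : borelRn R n) :
  row_mxRn (consRn (t, x), y) = consRn (t, row_mxRn (x, y)).
Proof.
apply/rowP => i; rewrite /row_mxRn /consRn/=.
rewrite mxE [in RHS]mxE.
case: splitP => j ij; case: splitP => k ik.
- rewrite !mxE; case: splitP => l jl; rewrite ?mxE//.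
  have := ltn_ord k; rewrite -ik ij jl//.
- rewrite !mxE; case: splitP => l jl; rewrite ?mxE.
    by have := ltn_ord l; rewrite -jl -ij ik.
  case: splitP => o ko.
    congr (x _ _); apply/val_inj => /=.
    by move: ik; rewrite ij jl ko => /addnI.
  have /addnI lE : (1 + l = 1 + (m + o))%N by rewrite -ko -ik ij.
  by have := ltn_ord l; rewrite lE ltnNge leq_addr.
- by have := ltn_ord k; rewrite -ik ij.
- rewrite !mxE; case: splitP => o ko.
    have /addnI oE : (1 + (m + j) = 1 + o)%N by rewrite -ko -ik ij.
    by have := ltn_ord o; rewrite -oE ltnNge leq_addr.
  have /addnI/addnI jE : (1 + (m + j) = 1 + (m + o))%N by rewrite -ko -ik ij.
  by congr (y _ _); exact/val_inj.
Qed.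

Lemma row_mxRn0 n x (y : borelRn R n) : @row_mxRn 0 n (x, y) = y.
Proof.
apply/rowP => i; rewrite /row_mxRn mxE; case: splitP => [[]//|j ij /=].
by congr (y _ _); exact/val_inj.
Qed.

Lemma integral_borel_lebesgueS n (f : borelRn R n.+1 -> \bar R) :
  measurable_fun setT f -> (forall z, 0 <= f z) ->
  \int[borel_lebesgue R n.+1]_z f z =
  \int[@lebesgue_measure R]_t \int[borel_lebesgue R n]_x f (consRn (t, x)).
Proof.
move=> mf f0.
have mcons : @measurable_fun _ _ (measurableTypeR R * borelRn R n)%type _
    setT (@consRn R n) by exact: measurable_consRn.
transitivity (\int[@lebesgue_measure R \x borel_lebesgue R n]_p f (consRn p)).
  exact: (@ge0_integral_pushforward _ _ (measurableTypeR R * borelRn R n)%type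
    (borelRn R n.+1) R _ mcons (@lebesgue_measure R \x borel_lebesgue R n)%E
    setT f measurableT mf (fun z _ => f0 z)).
have mfc : @measurable_fun _ _ (measurableTypeR R * borelRn R n)%type _
    setT (f \o @consRn R n) by exact: measurableT_comp.
exact: (@fubini_tonelli1 _ _ (measurableTypeR R) (borelRn R n) R
  (@lebesgue_measure R) (borel_lebesgue R n) _ mfc (fun=> f0 _)).
Qed.

(** Induction on [m]. For [m = 0] the outer measure is the Dirac mass at the only point of R^0; the
    inductive step integrates over the first coordinate on both sides. *)
Lemma integral_borel_lebesgueD m n (f : borelRn R (m + n) -> \bar R) :
  measurable_fun setT f -> (forall z, 0 <= f z) ->
  \int[borel_lebesgue R (m + n)]_z f z =
  \int[borel_lebesgue R m]_x \int[borel_lebesgue R n]_y f (row_mxRn (x, y)).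
Proof.
elim: m f => [|m IH] f mf f0.
  rewrite [RHS]integral_dirac//; last first.
    apply: (measurable_fun_fubini_tonelli_F (f \o @row_mxRn 0 n)) => //.
      by apply: measurableT_comp => //; exact: measurable_row_mxRn.
    by move=> x; exact: f0.
  by rewrite diracT mul1e; apply: eq_integral => y _; rewrite row_mxRn0.
have mfr : measurable_fun setT (f \o @row_mxRn m.+1 n).
  by apply: measurableT_comp => //; exact: measurable_row_mxRn.
have mF := @measurable_fun_fubini_tonelli_F _ _ _ _ _ (borel_lebesgue R n) _ mfr
  (fun=> f0 _).
rewrite [RHS](integral_borel_lebesgueS mF); last first.
  by move=> x; apply: integral_ge0 => y _; exact: f0.
rewrite [LHS](@integral_borel_lebesgueS (m + n))//.
apply: eq_integral => t _ /=.
have mft : measurable_fun setT (fun z : borelRn R (m + n) => f (consRn (t, z))).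
  apply: (measurableT_comp mf).
  apply: (measurableT_comp (@measurable_consRn R (m + n))).
  exact: pair1_measurable.
rewrite (IH _ mft)//.
by apply: eq_integral => x _; apply: eq_integral => y _ /=; rewrite row_mx_consRn.
Qed.

(** Both iterated integrals of the indicator of [N] vanish, hence almost every inner integral does,
    and then the indicator itself almost everywhere on the section. *)
Lemma null_sections m n (N : set (borelRn R (m + n))) :
  measurable N -> borel_lebesgue R (m + n) N = 0 ->
  (\forall x \ae borel_lebesgue R m, \forall y \ae borel_lebesgue R n,
     ~ N (row_mxRn (x, y))) /\
  (\forall y \ae borel_lebesgue R n, \forall x \ae borel_lebesgue R m,
     ~ N (row_mxRn (x, y))).
Proof.
move=> mN N0.
pose f (z : borelRn R (m + n)) : \bar R := (\1_N z)%:E.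
have mf : measurable_fun setT f by exact/measurable_EFinP/measurable_indic.
have f0 z : 0 <= f z by rewrite lee_fin.
have mfr : measurable_fun setT (f \o @row_mxRn m n).
  by apply: measurableT_comp => //; exact: measurable_row_mxRn.
have fN z : f z = 0 -> ~ N z.
  by rewrite /f indicE => -[] /eqP; rewrite pnatr_eq0 eqb0 => /negP zN /mem_set.
have I1 := integral_borel_lebesgueD mf f0.
have IN : \int[borel_lebesgue R (m + n)]_z f z = 0.
  by rewrite /f (integral_indic (borel_lebesgue R (m + n)) measurableT mN) setIT.
rewrite IN in I1.
have mF := measurable_fun_fubini_tonelli_F _ mfr (fun x => f0 _).
have mG := measurable_fun_fubini_tonelli_G _ mfr (fun x => f0 _).
have secx x : measurable_fun setT (fun y => f (row_mxRn (x, y))).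
  exact: (measurableT_comp mfr).
have secy y : measurable_fun setT (fun x => f (row_mxRn (x, y))).
  exact: (measurableT_comp mfr).
split.
  have : \forall x \ae borel_lebesgue R m,
      \int[borel_lebesgue R n]_y f (row_mxRn (x, y)) = 0.
    have sx := ge0_integral_eq0_ae measurableT (mF _) _ (esym I1).
    apply: filterS (sx _) => [x|x]; first exact.
    by apply: integral_ge0 => y _; exact: f0.
  apply: filterS => x /(ge0_integral_eq0_ae measurableT (secx x) (fun=> f0 _)).
  by apply: filterS => y /(_ I)/fN.
have : \forall y \ae borel_lebesgue R n,
    \int[borel_lebesgue R m]_x f (row_mxRn (x, y)) = 0.
  have I2 := etrans (esym (fubini_tonelli _ mfr (fun=> f0 _))) (esym I1).
  have sy := ge0_integral_eq0_ae measurableT (mG _) _ I2.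
  apply: filterS (sy _) => [y|y]; first exact.
  by apply: integral_ge0 => x _; exact: f0.
apply: filterS => y /(ge0_integral_eq0_ae measurableT (secy y) (fun=> f0 _)).
by apply: filterS => x /(_ I)/fN.
Qed.

End lebesgueRn_product.

(** * Open sets are Borel, and the kernel that replaces gamma *)

Lemma open_measurable_borelRn (R : realType) d (O : set 'rV[R]_d) :
  open O -> measurable (O : set (borelRn R d)).
Proof.
move=> oO.
(* Cubes with rational centre and radius 1 / (n + 1): there are countably many, each is a finite
   intersection of preimages under coordinates, and [O] is the union of those it contains. *)
pose box (p : 'rV[rat]_d * nat) : set 'rV[R]_d :=
  [set x | forall i, `|ratr (p.1 ord0 i) - x ord0 i| < p.2.+1%:R^-1].
have mbox p : measurable (box p : set (borelRn R d)).
  rewrite (_ : box p = \big[setI/setT]_(i < d)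
      ((fun x : borelRn R d => (x : 'rV[R]_d) ord0 i) @^-1`
        ball (ratr (p.1 ord0 i) : R) p.2.+1%:R^-1)).
    apply: bigsetI_measurable => i _; rewrite -[X in measurable X]setTI.
    by apply: measurable_coord => //; exact: measurable_ball.
  rewrite -bigcap_seq; apply/seteqP; split => x.
    by move=> xp i /= _; exact: xp.
  by move=> xp i; apply: (xp i); rewrite /= mem_index_enum.
pose S := [set p | box p `<=` O].
rewrite (_ : O = \bigcup_p (if p \in S then box p else set0)).
  by apply: countable_bigcupT_measurable => [|p]; [exact: countableP|case: ifPn].
apply/seteqP; split => [x Ox|x [p _]]; last first.
  by case: ifPn => // /set_mem; exact.
have /nbhs_ballP[e /= e0 xeO] : nbhs x O by exact: open_nbhs_nbhs.
(* Half of [e], because both the centre and any other point of the cube lie within 1 / (n + 1) of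
   each other, and [x] reaches such a point through the centre. *)
have [n _ ne] := near_infty_natSinv_lt (PosNum (divr_gt0 e0 (ltr0n _ 2))).
have {}ne := ne n (leqnn n); rewrite /= in ne.
have /choice[q qx] i : exists q : rat, `|ratr q - x ord0 i| < n.+1%:R^-1.
  have : x ord0 i - n.+1%:R^-1 < x ord0 i + n.+1%:R^-1 by rewrite ltrD2l gtrN// invr_gt0.
  by move=> /rat_in_itvoo[q]; rewrite in_itv/= -ltr_distl; exists q.
have boxq : box (\row_i q i, n) x by move=> i; rewrite mxE.
exists (\row_i q i, n) => //; rewrite ifT//; apply/mem_set => y yq.
apply: xeO; split => // i j.
have -> : i = ord0 by apply/val_inj; case: i => -[].
have := yq j; have := qx j; rewrite !mxE/= => xq qy; rewrite -ball_normE/=.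
rewrite (le_lt_trans (ler_distD (ratr (q j)) _ _))//.
by rewrite (splitr e) ltrD//; [rewrite distrC|]; exact: lt_trans ne.
Qed.

#[global] Instance lebesgue_ae_filter (R : realType) d :
  Filter (almost_everywhere (lebesgue R d)).
Proof. exact: ae_filter_ringOfSetsType. Qed.

(** [k] is [gamma] with its values on the exceptional Borel null set replaced by 0. The two orders
    serve different integrals: almost every [x] for the mass, the energies and E, almost every [y]
    for the weights of W and for Gamma. *)
Lemma lebesgue_kernel (R : realType) d (gamma : 'rV[R]_d -> 'rV[R]_d -> R) :
  (forall y x, 0 <= gamma y x) ->
  lebesgue_measurable_fun setT
    (fun z : 'rV[R]_(d + d) => gamma (lsubmx z) (rsubmx z)) ->
  exists k : lebesgueRn R d * lebesgueRn R d -> R,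
  [/\ measurable_fun setT k, forall p, 0 <= k p,
      \forall x \ae lebesgue R d, \forall y \ae lebesgue R d, gamma y x = k (y, x) &
      \forall y \ae lebesgue R d, \forall x \ae lebesgue R d, gamma y x = k (y, x)].
Proof.
move=> g0 /completion_measurable_fun-/(_ (sigma_finiteT _))[N [mN N0 mg]].
set g := (X in X \_ (~` N)) in mg.
exists (fun p => (g \_ (~` N)) (@row_mxRn R d d p)).
have [Nx Ny] := null_sections mN N0.
have gk y x : ~ N (row_mxRn (y, x)) -> gamma y x = (g \_ (~` N)) (row_mxRn (y, x)).
  by move=> Nyx; rewrite patchE mem_set// /g /row_mxRn row_mxKl row_mxKr.
split.
(* The identity from the completed to the Borel sigma-algebra is measurable. Applied in each factor,
   it makes Borel functions on R^(d+d) measurable for the product of the completed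
   sigma-algebras. *)
- have mid : @measurable_fun _ _ (lebesgueRn R d) (borelRn R d) setT id.
    by apply: measurable_fun_completion; exact: measurable_id.
  have mpair : @measurable_fun _ _ (lebesgueRn R d * lebesgueRn R d)%type
      (borelRn R d * borelRn R d)%type setT id.
    apply/measurable_fun_pairP; split.
      exact: (measurableT_comp mid measurable_fst).
    exact: (measurableT_comp mid measurable_snd).
  have mrow := measurableT_comp (@measurable_row_mxRn R d d) mpair.
  exact: (measurableT_comp mg mrow).
- by move=> p; rewrite patchE; case: ifPn => // _; exact: g0.
- have Ly : \forall x \ae lebesgue R d, \forall y \ae borel_lebesgue R d,
    ~ N (row_mxRn (y, x)) := ae_completion Ny.
  apply: filterS Ly => x /ae_completion Nyx.
  have {}Nyx : \forall y \ae lebesgue R d, ~ N (row_mxRn (y, x)) := Nyx.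
  by apply: filterS Nyx => y; exact: gk.
- have Lx : \forall y \ae lebesgue R d, \forall x \ae borel_lebesgue R d,
    ~ N (row_mxRn (y, x)) := ae_completion Nx.
  apply: filterS Lx => y /ae_completion Nyx.
  have {}Nyx : \forall x \ae lebesgue R d, ~ N (row_mxRn (y, x)) := Nyx.
  by apply: filterS Nyx => x; exact: gk.
Qed.

(** * Estimates at a fixed point of Omega *)

Section weighted_moments.
Context d (T : measurableType d) (R : realType).
Variable mu : {measure set T -> \bar R}.
Variables (G : set T) (p u : T -> R).
Hypotheses (mG : measurable G) (mp : measurable_fun [set: T] p).
Hypotheses (p0 : forall y, 0 <= p y) (mu_ : measurable_fun [set: T] u).
Hypothesis ip : mu.-integrable G (fun y => (p y)%:E).
Hypothesis iq : mu.-integrable G (fun y => (u y ^+ 2 * p y)%:E).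

Let s := \int[mu]_(y in G) p y.
Let e := \int[mu]_(y in G) (u y * p y).
Let q := \int[mu]_(y in G) (u y ^+ 2 * p y).

(** Domination by (1 + u^2) p, where |u| <= 1 + u^2 follows from (|u| - 1)^2 >= 0. *)
Lemma integrable_moment1 : mu.-integrable G (fun y => (u y * p y)%:E).
Proof.
have ipq : mu.-integrable G (fun y => (p y)%:E + (u y ^+ 2 * p y)%:E)%E.
  exact: integrableD.
apply: le_integrable ipq => //.
  apply/measurable_EFinP; apply: measurable_funTS; exact: measurable_funM.
move=> y _ /=; rewrite lee_fin normrM (ger0_norm (p0 y)) [leRHS]ger0_norm; last first.
  by rewrite addr_ge0// mulr_ge0// sqr_ge0.
have : `|u y| <= 1 + u y ^+ 2.
  rewrite -(real_normK (num_real (u y))).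
  by have := sqr_ge0 (`|u y| - 1); have := normr_ge0 (u y); nra.
by move=> /(ler_wpM2r (p0 y)); rewrite mulrDl mul1r.
Qed.

Let quadE a b g : (fun y => ((a * u y ^+ 2 + b * u y + g) * p y)%:E) =
  (fun y => a%:E * (u y ^+ 2 * p y)%:E + (b%:E * (u y * p y)%:E + g%:E * (p y)%:E))%E.
Proof. by apply/funext => y; rewrite -!EFinM -!EFinD; congr EFin; ring. Qed.

(** Linearity, used once and for all: later proofs only have to write their integrand as such a
    polynomial in [u]. *)
Lemma integral_quadratic a b g :
  (\int[mu]_(y in G) ((a * u y ^+ 2 + b * u y + g) * p y)%:E =
   (a * q + b * e + g * s)%:E)%E.
Proof.
have i1 := integrable_moment1.
rewrite quadE integralD//; last 2 first.
- exact: integrableZl.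
- by apply: integrableD => //; apply: integrableZl.
rewrite integralD//; [|exact: integrableZl..].
rewrite !integralZl// /q /e /s /Rintegral !EFinD !EFinM !fineK ?addeA//;
  exact: integrable_fin_num.
Qed.

Lemma sqr_moment1_le : s <= 1 -> e ^+ 2 <= q.
Proof.
move=> s1; have : (0 <= (1 * q + (- (2 * e)) * e + e ^+ 2 * s)%:E)%E.
  rewrite -integral_quadratic; apply: integral_ge0 => y _; rewrite lee_fin.
  rewrite (_ : _ + _ = (u y - e) ^+ 2); last by ring.
  by rewrite mulr_ge0// sqr_ge0.
by rewrite lee_fin; have := sqr_ge0 e; nra.
Qed.

(** For fixed [z] the inner integrand is quadratic in [u y], and its integral is quadratic in [u z],
    so [integral_quadratic] applies twice. The factor [b] will be D, since k(y) k(z) / D = D p(y)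
    p(z). *)
Lemma integral_sqr_diff b :
  (\int[mu]_(z in G) \int[mu]_(y in G) ((u y - u z) ^+ 2 * (b * (p y * p z)))%:E =
   (b * (2 * (q * s - e ^+ 2)))%:E)%E.
Proof.
transitivity (\int[mu]_(z in G)
    ((b * s * u z ^+ 2 + (- (2 * b * e)) * u z + b * q) * p z)%:E)%E.
  apply: eq_integral => z _.
  rewrite (_ : (fun y => _) = (fun y => ((b * p z * u y ^+ 2 +
      (- (2 * b * p z * u z)) * u y + b * p z * u z ^+ 2) * p y)%:E)).
    by rewrite integral_quadratic; congr EFin; ring.
  by apply/funext => y; congr EFin; ring.
by rewrite integral_quadratic; congr EFin; ring.
Qed.

End weighted_moments.

(** * Mean, energy and trace bounds for one section of the kernel *)

Section section_estimates.
Context d (T : measurableType d) (R : realType).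
Variable mu : {measure set T -> \bar R}.
Variables (G : set T) (k : T -> R) (c : R).
Hypotheses (mG : measurable G) (mk : measurable_fun [set: T] k).
Hypotheses (k0 : forall y, 0 <= k y) (c0 : 0 <= c).
Implicit Types u h : T -> R.
Hypothesis koo : (\int[mu]_(y in G) (k y)%:E < +oo)%E.

Let D := fine (\int[mu]_(y in G) (k y)%:E)%E + c.

Hypothesis D0 : 0 < D.

Let p y := k y / D.
Let mp : measurable_fun [set: T] p. Proof. exact: measurable_funM. Qed.
Let p0 y : 0 <= p y. Proof. by rewrite divr_ge0// ltW. Qed.
Let s := \int[mu]_(y in G) p y.

Let pE : (fun y => (p y)%:E) = (fun y => (D^-1)%:E * (k y)%:E)%E.
Proof. by apply/funext => y; rewrite -EFinM mulrC. Qed.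

Let ik : mu.-integrable G (fun y => (k y)%:E).
Proof.
apply/integrableP; split; first by apply/measurable_EFinP; exact: measurable_funTS.
by under eq_integral do rewrite gee0_abs ?lee_fin//.
Qed.

Let ip : mu.-integrable G (fun y => (p y)%:E).
Proof. by rewrite pE; exact: integrableZl. Qed.

Let sE : D * s + c = D.
Proof.
rewrite /s /Rintegral pE integralZl// fineM//; last exact: integrable_fin_num.
by rewrite /= mulrA divff ?mul1r// gt_eqF.
Qed.

Let s1 : s <= 1.
Proof. by rewrite -(ler_pM2l D0) mulr1 -[leRHS]sE lerDl. Qed.

Let iq u : measurable_fun [set: T] u ->
  (\int[mu]_(y in G) (u y ^+ 2 * p y)%:E < +oo)%E ->
  mu.-integrable G (fun y => (u y ^+ 2 * p y)%:E).
Proof.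
move=> mu_ uoo; apply/integrableP; split.
  apply/measurable_EFinP; apply: measurable_funTS.
  by apply: measurable_funM => //; exact: measurable_funX.
rewrite (eq_integral (fun y => (u y ^+ 2 * p y)%:E))// => y _.
by rewrite gee0_abs// lee_fin mulr_ge0// sqr_ge0.
Qed.

Let qE u : measurable_fun [set: T] u ->
  (\int[mu]_(y in G) (u y ^+ 2 * p y)%:E < +oo)%E ->
  (\int[mu]_(y in G) (u y ^+ 2 * p y)%:E =
    (\int[mu]_(y in G) (u y ^+ 2 * p y))%R%:E)%E.
Proof.
by move=> mu_ uoo; rewrite fineK//; apply: integrable_fin_num => //; exact: iq.
Qed.

Lemma section_integrable u : measurable_fun [set: T] u ->
  (\int[mu]_(y in G) (u y ^+ 2 * (k y / D))%:E < +oo)%E ->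
  mu.-integrable G (fun y => (u y * (k y / D))%:E).
Proof. by move=> mu_ uoo; apply: integrable_moment1 => //; exact: iq. Qed.

Lemma section_mean_sqr_le u : measurable_fun [set: T] u ->
  (\int[mu]_(y in G) (u y ^+ 2 * (k y / D))%:E < +oo)%E ->
  (((\int[mu]_(y in G) (u y * (k y / D))) ^+ 2)%R%:E <=
   \int[mu]_(y in G) (u y ^+ 2 * (k y / D))%:E)%E.
Proof.
move=> mu_ uoo; rewrite qE// lee_fin; apply: sqr_moment1_le => //; exact: iq.
Qed.

Let diffE u : measurable_fun [set: T] u ->
  (\int[mu]_(y in G) (u y ^+ 2 * p y)%:E < +oo)%E ->
  (\int[mu]_(z in G) \int[mu]_(y in G)
     ((u y - u z) ^+ 2 * (k y * k z / D))%:E =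
   (D * (2 * ((\int[mu]_(y in G) (u y ^+ 2 * p y)) * s -
              (\int[mu]_(y in G) (u y * p y)) ^+ 2)))%R%:E)%E.
Proof.
move=> mu_ uoo; rewrite -integral_sqr_diff//; last exact: iq.
apply: eq_integral => z _; apply: eq_integral => y _.
by congr EFin; rewrite /p; field; rewrite gt_eqF.
Qed.

Lemma section_extension_energy u : measurable_fun [set: T] u ->
  (\int[mu]_(y in G) (u y ^+ 2 * (k y / D))%:E < +oo)%E ->
  (\int[mu]_(y in G) ((\int[mu]_(z in G) (u z * (k z / D)) - u y) ^+ 2 * k y)%R%:E <=
   c%:E * \int[mu]_(y in G) (u y ^+ 2 * (k y / D))%:E +
   \int[mu]_(z in G) \int[mu]_(y in G)
     ((u y - u z) ^+ 2 * (k y * k z / D))%:E)%E.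
Proof.
move=> mu_ uoo; rewrite diffE// qE//.
set e := Rintegral _ _ (fun y => u y * _).
set q := Rintegral _ _ _.
have eq2 : e ^+ 2 <= q by apply: sqr_moment1_le => //; exact: iq.
(* Nonnegativity is read off from the double integral. It allows D (q s - e^2), which occurs in the
   energy, to be bounded by its double. *)
have J0 : 0 <= D * (2 * (q * s - e ^+ 2)).
  rewrite -lee_fin -diffE//; apply: integral_ge0 => z _; apply: integral_ge0 => y _.
  by rewrite lee_fin mulr_ge0 ?sqr_ge0// divr_ge0 ?mulr_ge0// ltW.
rewrite (_ : (fun y => _) = (fun y => ((D * u y ^+ 2 + (- (2 * D * e)) * u y +
    D * e ^+ 2) * p y)%:E)); last first.
  by apply/funext => y; congr EFin; rewrite /p; field; rewrite gt_eqF.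
rewrite integral_quadratic//; last exact: iq.
rewrite -/s -/e -/q -EFinM -EFinD lee_fin.
have -> : D * q + - (2 * D * e) * e + D * e ^+ 2 * s =
    D * (q * s - e ^+ 2) + (D - D * s) * (q - e ^+ 2) by ring.
have -> : D - D * s = c by rewrite -[X in X - _]sE addrC addKr.
rewrite addrC lerD//; first by rewrite ler_wpM2l// lerBlDr lerDl sqr_ge0.
by move: J0; set w := q * s - _; nra.
Qed.

Let hE h : measurable_fun [set: T] h ->
  (D%:E * \int[mu]_(y in G) (h y ^+ 2 * p y)%:E =
   \int[mu]_(y in G) (h y ^+ 2 * k y)%:E)%E.
Proof.
move=> mh; rewrite -ge0_integralZl_EFin ?ltW//.
- apply: eq_integral => y _; rewrite -EFinM /p; congr EFin; field.
  by rewrite gt_eqF.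
- by move=> y _; rewrite lee_fin mulr_ge0// sqr_ge0.
- apply/measurable_EFinP; apply: measurable_funTS.
  by apply: measurable_funM => //; exact: measurable_funX.
Qed.

Let q_lty h : measurable_fun [set: T] h ->
  (\int[mu]_(y in G) (h y ^+ 2 * k y)%:E < +oo)%E ->
  (\int[mu]_(y in G) (h y ^+ 2 * p y)%:E < +oo)%E.
Proof.
move=> mh; rewrite -hE//; set Q := integral _ _ _.
have [->|Qoo _] := eqVneq Q +oo%E; last by rewrite ltey.
by rewrite gt0_muley// lte_fin.
Qed.

Let q_ge0 h : 0 <= \int[mu]_(y in G) (h y ^+ 2 * p y).
Proof.
by apply: fine_ge0; apply: integral_ge0 => y _; rewrite lee_fin mulr_ge0// sqr_ge0.
Qed.

Lemma section_trace_weight u t a : 0 < a -> a <= D -> measurable_fun [set: T] u ->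
  (\int[mu]_(y in G) (u y ^+ 2 * (k y / D))%:E <=
   (2 / a)%:E * \int[mu]_(y in G) ((t - u y) ^+ 2 * k y)%:E + (2 * t ^+ 2)%:E)%E.
Proof.
move=> a0 aD mu_; pose h y := t - u y.
have mh : measurable_fun [set: T] h by exact: measurable_funB.
have [->|] := eqVneq (\int[mu]_(y in G) (h y ^+ 2 * k y)%:E)%E +oo%E.
  by rewrite gt0_muley ?addye ?leey// lte_fin divr_gt0.
rewrite -ltey => /(q_lty mh) hoo.
rewrite -hE// (_ : (fun y => (u y ^+ 2 * _)%:E) = (fun y => ((1 * h y ^+ 2 +
    (- (2 * t)) * h y + t ^+ 2) * p y)%:E)); last first.
  by apply/funext => y; congr EFin; rewrite /p /h; ring.
rewrite integral_quadratic//; last exact: iq.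
have eq2 := sqr_moment1_le mG mp p0 mh ip (iq mh hoo) s1.
rewrite qE// -!EFinM -EFinD lee_fin.
move: (q_ge0 h) eq2; set e := Rintegral _ _ (fun y => h y * _).
set q := Rintegral _ _ _ => q0 eq2; rewrite -/s.
have : q <= D / a * q by rewrite ler_peMl// ler_pdivlMr// mul1r.
have -> : 2 / a * (D * q) = 2 * (D / a * q) by ring.
(* The left side is q - 2 t e + t^2 s. Here -2 t e <= t^2 + e^2 <= t^2 + q and s <= 1, which gives 2
   q + 2 t^2, and q <= (D / a) q. *)
have := sqr_ge0 (t + e); have := sqr_ge0 t; move: s1.
by nra.
Qed.

(** Differences of [u] are, up to sign, differences of [h = t - u], for which 2 D (q s - e^2) <= 2 D
    q. The number [t] will be the value of [u] at the fixed point of Omega. *)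
Lemma section_trace_energy u t : measurable_fun [set: T] u ->
  (\int[mu]_(z in G) \int[mu]_(y in G) ((u y - u z) ^+ 2 * (k y * k z / D))%:E <=
   2%:E * \int[mu]_(y in G) ((t - u y) ^+ 2 * k y)%:E)%E.
Proof.
move=> mu_; pose h y := t - u y.
have mh : measurable_fun [set: T] h by exact: measurable_funB.
have [->|] := eqVneq (\int[mu]_(y in G) (h y ^+ 2 * k y)%:E)%E +oo%E.
  by rewrite gt0_muley ?leey// lte_fin.
rewrite -ltey => /(q_lty mh) hoo.
rewrite -hE// (_ : (fun z => _) = (fun z =>
    \int[mu]_(y in G) ((h y - h z) ^+ 2 * (k y * k z / D))%:E)%E); last first.
  apply/funext => z; apply: eq_integral => y _.
  by congr EFin; rewrite /h; ring.
rewrite diffE// qE// -!EFinM lee_fin [leRHS]mulrCA !ler_pM2l// lerBlDr.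
by rewrite -[leLHS]addr0 lerD ?sqr_ge0// ler_piMr// q_ge0.
Qed.

End section_estimates.

(** * Trace and extension for a product-measurable kernel *)

Section tonelli_domains.
Local Open Scope ereal_scope.
Context d1 d2 (T1 : measurableType d1) (T2 : measurableType d2) (R : realType).
Variables (m1 : {sigma_finite_measure set T1 -> \bar R})
  (m2 : {sigma_finite_measure set T2 -> \bar R}).
Variables (D1 : set T1) (D2 : set T2).
Hypotheses (mD1 : measurable D1) (mD2 : measurable D2).
Variable F : T1 * T2 -> \bar R.
Hypotheses (mF : measurable_fun [set: T1 * T2] F) (F0 : forall x, 0 <= F x).

Let FD := F \_ (D1 `*` D2).

Let mFD : measurable_fun [set: T1 * T2] FD.
Proof.
apply/(measurable_restrictT F); [exact: measurableX|exact: measurable_funTS].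
Qed.

Let FD0 x : 0 <= FD x.
Proof. by rewrite /FD patchE; case: ifPn. Qed.

Let sectionE x : ((fun x => \int[m2]_(y in D2) F (x, y)) \_ D1) x =
  \int[m2]_y FD (x, y).
Proof.
rewrite patchE; case: ifPn => xD1.
  rewrite integral_mkcond; apply: eq_integral => y _.
  by rewrite /FD !patchE in_setX xD1.
rewrite integral0_eq// => y _.
by rewrite /FD patchE in_setX (negbTE xD1).
Qed.

Let sectionE' y : ((fun y => \int[m1]_(x in D1) F (x, y)) \_ D2) y =
  \int[m1]_x FD (x, y).
Proof.
rewrite patchE; case: ifPn => yD2.
  rewrite integral_mkcond; apply: eq_integral => x _.
  by rewrite /FD !patchE in_setX yD2 andbT.
rewrite integral0_eq// => x _.
by rewrite /FD patchE in_setX (negbTE yD2) andbF.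
Qed.

Lemma tonelli_on1 : \int[m1]_(x in D1) \int[m2]_(y in D2) F (x, y) =
  \int[m1 \x m2]_(z in D1 `*` D2) F z.
Proof.
rewrite [RHS]integral_mkcond (fubini_tonelli1 _ mFD FD0) integral_mkcond.
by apply: eq_integral => x _; rewrite sectionE.
Qed.

Lemma tonelli_on : \int[m1]_(x in D1) \int[m2]_(y in D2) F (x, y) =
  \int[m2]_(y in D2) \int[m1]_(x in D1) F (x, y).
Proof.
rewrite integral_mkcond [RHS]integral_mkcond.
under eq_integral do rewrite sectionE.
under [RHS]eq_integral do rewrite sectionE'.
exact: fubini_tonelli.
Qed.

End tonelli_domains.

Lemma measurable_fun_section_integral d1 d2 (T1 : measurableType d1)
    (T2 : measurableType d2) (R : realType)
    (m2 : {sigma_finite_measure set T2 -> \bar R}) (D2 : set T2)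
    (F : T1 * T2 -> \bar R) :
  measurable D2 -> measurable_fun [set: T1 * T2] F -> (forall x, 0 <= F x)%E ->
  measurable_fun [set: T1] (fun x => \int[m2]_(y in D2) F (x, y))%E.
Proof.
move=> mD2 mF F0.
rewrite (_ : (fun x => _) = (fun x => \int[m2]_y (F \_ ([set: T1] `*` D2)) (x, y))%E).
  apply: (measurable_fun_fubini_tonelli_F (F \_ ([set: T1] `*` D2))).
    apply/(measurable_restrictT F); first exact: measurableX.
    exact: measurable_funTS.
  by move=> x; rewrite patchE; case: ifPn.
apply/funext => x; rewrite integral_mkcond; apply: eq_integral => y _.
by rewrite !patchE in_setX in_setT.
Qed.

Lemma ae_integral_lty d (T : measurableType d) (R : realType)
    (mu : {measure set T -> \bar R}) (D : set T) (f : T -> \bar R) :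
  measurable D -> measurable_fun [set: T] f -> (forall x, 0 <= f x)%E ->
  (\int[mu]_(x in D) f x < +oo)%E -> \forall x \ae mu, D x -> (f x < +oo)%E.
Proof.
move=> mD mf f0 foo.
have : mu.-integrable D f.
  apply/integrableP; split; first exact: measurable_funTS.
  by under eq_integral do rewrite gee0_abs//.
move=> /(integrable_ae mD); apply: filterS => x fx /fx.
by rewrite ge0_fin_numE.
Qed.

(** From (a f + g)^2 <= 2 a^2 f^2 + 2 g^2. The weight is extended real because that of W may be
    infinite; with suitable weights the lemma serves W, V and L^2 alike. *)
Lemma sqr_lincomb_integral_lty d (T : measurableType d) (R : realType)
    (mu : {measure set T -> \bar R}) (D : set T) (f g : T -> R) (w : T -> \bar R)
    (a : R) :
  measurable D -> measurable_fun [set: T] f -> measurable_fun [set: T] g ->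
  measurable_fun [set: T] w -> (forall x, 0 <= w x)%E ->
  (\int[mu]_(x in D) ((f x ^+ 2)%:E * w x) < +oo)%E ->
  (\int[mu]_(x in D) ((g x ^+ 2)%:E * w x) < +oo)%E ->
  (\int[mu]_(x in D) (((a * f x + g x) ^+ 2)%:E * w x) < +oo)%E.
Proof.
move=> mD mf mg mw w0 foo goo.
have msq (h : T -> R) : measurable_fun [set: T] h ->
    measurable_fun D (fun x => (h x ^+ 2)%:E * w x)%E.
  move=> mh; apply: measurable_funTS; apply: emeasurable_funM => //.
  by apply/measurable_EFinP; exact: measurable_funX.
have sq0 (h : T -> R) x : (0 <= (h x ^+ 2)%:E * w x)%E by rewrite mule_ge0// lee_fin sqr_ge0.
apply: (@le_lt_trans _ _ (\int[mu]_(x in D)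
  ((2 * a ^+ 2)%:E * ((f x ^+ 2)%:E * w x) + 2%:E * ((g x ^+ 2)%:E * w x)))%E).
  apply: ge0_le_integral_lower => x _; first by rewrite (sq0 (fun x => a * f x + g x)).
  rewrite !muleA -!EFinM -ge0_muleDl ?lee_fin; last 2 first.
  - by rewrite mulr_ge0 ?sqr_ge0// mulr_ge0// sqr_ge0.
  - by rewrite mulr_ge0// sqr_ge0.
  rewrite lee_wpmul2r// -EFinD lee_fin.
  by have := sqr_ge0 (a * f x - g x); nra.
rewrite ge0_integralD//.
- rewrite !ge0_integralZl_EFin//; [|exact: msq|exact: msq|by rewrite mulr_ge0// sqr_ge0].
  by rewrite lte_add_pinfty// lte_mul_pinfty// lee_fin// mulr_ge0// sqr_ge0.
- by move=> x _; rewrite mule_ge0// lee_fin mulr_ge0// sqr_ge0.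
- by apply: emeasurable_funM => //; exact: msq.
- by move=> x _; rewrite mule_ge0.
- by apply: emeasurable_funM => //; exact: msq.
Qed.

(** On nonnegative reals the inverse is the power of exponent -1, also at 0, where both are 0. *)
Lemma measurable_fun_inv d (T : measurableType d) (R : realType) (f : T -> R) :
  measurable_fun [set: T] f -> (forall x, 0 <= f x) ->
  measurable_fun [set: T] (fun x => (f x)^-1).
Proof.
move=> mf f0; rewrite (_ : (fun x => _) = (@powR R)^~ (-1) \o f).
  by apply: measurableT_comp => //; exact: measurable_powR.
by apply/funext => x /=; rewrite powR_inv1.
Qed.

Lemma ge0_adde_lty (R : realType) (x y : \bar R) : (0 <= x)%E -> (0 <= y)%E ->
  (x + y < +oo)%E -> (x < +oo)%E /\ (y < +oo)%E.
Proof.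
by move=> x0 y0 xy; split; apply: le_lt_trans xy; [rewrite leeDl|rewrite leeDr].
Qed.

(** The constant of (ii): [q] and [j] are the two parts of the squared W norm, [q] bounds the L^2
    part of the extension and [c q + j] its energy. *)
Lemma extension_const_le (R : realType) (c : R) (q j : \bar R) :
  0 <= c -> (0 <= q)%E -> (0 <= j)%E ->
  (q + (c%:E * q + j) <= (1 + c)%:E * (q + j))%E.
Proof.
move=> c0 q0 j0; rewrite EFinD ge0_muleDl ?lee_fin// mul1e ge0_muleDr//.
rewrite -[leRHS]addeA; apply: leeD2l; rewrite [leLHS]addeC; apply: leeD2l.
by rewrite leeDl// mule_ge0// lee_fin.
Qed.

(** The constant of (i), with [b = 2 / a]: [u] is the L^2 part of the V norm, [i] the energy with
    [y] in Gamma and [j] the full energy. *)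
Lemma trace_const_le (R : realType) (b : R) (i j u : \bar R) :
  0 <= b -> (0 <= i)%E -> (0 <= u)%E -> (i <= j)%E ->
  (b%:E * i + 2%:E * u + 2%:E * i <= (b + 2)%:E * (u + j))%E.
Proof.
move=> b0 i0 u0 ij; have j0 : (0 <= j)%E by exact: le_trans ij.
rewrite addeAC -ge0_muleDl ?lee_fin// -EFinD ge0_muleDr// addeC leeD//.
  by rewrite lee_wpmul2r// lee_fin lerDr.
by rewrite lee_wpmul2l// lee_fin addr_ge0.
Qed.

(** * Norms, extension and trace on an abstract measure space *)

(** [mu] is a bare set function, so that the same expression can be read with [lebesgue R d] and
    with its sigma-finite packaging. *)
Definition kernel_sqnormW d (T : measurableType d) (R : realType)
    (mu : set T -> \bar R) (O G : set T) (k : T * T -> R) (den u : T -> R) :=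
  (\int[mu]_(y in G) ((u y ^+ 2)%:E * \int[mu]_(x in O) (k (y, x) / den x)%:E) +
   \int[mu]_(z in G) \int[mu]_(y in G) (((u y - u z) ^+ 2)%:E *
     \int[mu]_(x in O) (k (y, x) * k (z, x) / den x)%:E))%E.

Definition kernel_sqnormV d (T : measurableType d) (R : realType)
    (mu : set T -> \bar R) (O : set T) (k : T * T -> R) (u : T -> R) :=
  (\int[mu]_(x in O) (u x ^+ 2)%:E +
   \int[mu]_(x in O) \int[mu]_y ((u x - u y) ^+ 2 * k (y, x))%:E)%E.

Section nonlocal_trace.
Context d (T : measurableType d) (R : realType).
Variable mu : {sigma_finite_measure set T -> \bar R}.
Variables (O G : set T) (k : T * T -> R) (c : R).
Hypotheses (mO : measurable O) (mG : measurable G).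
Hypotheses (mk : measurable_fun [set: T * T] k) (k0 : forall q, 0 <= k q).
Hypothesis c0 : 0 <= c.
Implicit Type u : T -> R.

Let mass x := (\int[mu]_(y in G) (k (y, x))%:E)%E.
Let den x := fine (mass x) + c.
Let p y x := k (y, x) / den x.
Let ext u x := \int[mu]_(y in G) (u y * p y x).

Local Notation sqW := (kernel_sqnormW mu O G k den).
Local Notation sqV := (kernel_sqnormV mu O k).

Let mkc d' (X : measurableType d') (f g : X -> T) :
  measurable_fun [set: X] f -> measurable_fun [set: X] g ->
  measurable_fun [set: X] (fun x => k (f x, g x)).
Proof. by move=> mf mg; apply: (measurableT_comp mk); exact/measurable_fun_pair. Qed.

Let mass0 x : (0 <= mass x)%E.
Proof. by apply: integral_ge0 => y _; rewrite lee_fin. Qed.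

Let den0 x : 0 <= den x.
Proof. by rewrite addr_ge0// fine_ge0. Qed.

Let mmass : measurable_fun [set: T] mass.
Proof.
apply: (@measurable_fun_section_integral _ _ _ _ _ mu G (fun q => (k (q.2, q.1))%:E)) => //.
  by apply/measurable_EFinP; exact: mkc.
by move=> x; rewrite lee_fin.
Qed.

Let mden : measurable_fun [set: T] den.
Proof.
apply: measurable_funD => //.
by apply: (measurableT_comp (fine_measurable measurableT)).
Qed.

Let mdenV : measurable_fun [set: T] (fun x => (den x)^-1).
Proof. exact: measurable_fun_inv. Qed.

Let mp d' (X : measurableType d') (f g : X -> T) :
  measurable_fun [set: X] f -> measurable_fun [set: X] g ->
  measurable_fun [set: X] (fun x => p (f x) (g x)).
Proof.
move=> mf mg; apply: measurable_funM; first exact: mkc.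
exact: (measurableT_comp mdenV).
Qed.

Let p0 y x : 0 <= p y x. Proof. by rewrite divr_ge0. Qed.

Let mw d' (X : measurableType d') (f g h : X -> T) :
  measurable_fun [set: X] f -> measurable_fun [set: X] g ->
  measurable_fun [set: X] h ->
  measurable_fun [set: X] (fun x => k (f x, h x) * k (g x, h x) / den (h x)).
Proof.
move=> mf mg mh; apply: measurable_funM; last exact: (measurableT_comp mdenV).
by apply: measurable_funM; exact: mkc.
Qed.

Let w0 y z x : 0 <= k (y, x) * k (z, x) / den x.
Proof. by rewrite divr_ge0// mulr_ge0. Qed.

Let weight y := (\int[mu]_(x in O) (p y x)%:E)%E.
Let weight2 z y := (\int[mu]_(x in O) (k (y, x) * k (z, x) / den x)%:E)%E.

Let mweight : measurable_fun [set: T] weight.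
Proof.
apply: (@measurable_fun_section_integral _ _ _ _ _ mu O (fun q => (p q.1 q.2)%:E)) => //.
  by apply/measurable_EFinP; exact: mp.
by move=> x; rewrite lee_fin.
Qed.

Let weight0 y : (0 <= weight y)%E.
Proof. by apply: integral_ge0 => x _; rewrite lee_fin. Qed.

Let mweight2 : measurable_fun [set: T * T] (fun q => weight2 q.1 q.2).
Proof.
apply: (@measurable_fun_section_integral _ _ _ _ _ mu O
  (fun q : (T * T) * T => (k (q.1.2, q.2) * k (q.1.1, q.2) / den q.2)%:E)) => //.
  apply/measurable_EFinP; apply: mw => //.
    exact: measurableT_comp measurable_snd measurable_fst.
  exact: measurableT_comp measurable_fst measurable_fst.
by move=> x; rewrite lee_fin.
Qed.

Let weight20 z y : (0 <= weight2 z y)%E.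
Proof. by apply: integral_ge0 => x _; rewrite lee_fin. Qed.

Let sqWE u : sqW u = (\int[mu]_(y in G) ((u y ^+ 2)%:E * weight y) +
  \int[mu]_(z in G) \int[mu]_(y in G) (((u y - u z) ^+ 2)%:E * weight2 z y))%E.
Proof. by []. Qed.

Let Q u x := (\int[mu]_(y in G) (u y ^+ 2 * p y x)%:E)%E.
Let J u x := (\int[mu]_(z in G) \int[mu]_(y in G)
  ((u y - u z) ^+ 2 * (k (y, x) * k (z, x) / den x))%:E)%E.

Let mQ u : measurable_fun [set: T] u -> measurable_fun [set: T] (Q u).
Proof.
move=> mu_; apply: (@measurable_fun_section_integral _ _ _ _ _ mu G
  (fun q => (u q.2 ^+ 2 * p q.2 q.1)%:E)) => //.
  apply/measurable_EFinP; apply: measurable_funM; last exact: mp.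
  by apply: measurable_funX; exact: measurableT_comp.
by move=> x; rewrite lee_fin mulr_ge0// sqr_ge0.
Qed.

Let Q0 u x : (0 <= Q u x)%E.
Proof. by apply: integral_ge0 => y _; rewrite lee_fin mulr_ge0// sqr_ge0. Qed.

Let Jin u z x := (\int[mu]_(y in G)
  ((u y - u z) ^+ 2 * (k (y, x) * k (z, x) / den x))%:E)%E.

Let mJin u : measurable_fun [set: T] u ->
  measurable_fun [set: T * T] (fun q => Jin u q.1 q.2).
Proof.
move=> mu_; apply: (@measurable_fun_section_integral _ _ _ _ _ mu G
  (fun q : (T * T) * T => ((u q.2 - u q.1.1) ^+ 2 *
    (k (q.2, q.1.2) * k (q.1.1, q.1.2) / den q.1.2))%:E)) => //; last first.
  by move=> x; rewrite lee_fin mulr_ge0// sqr_ge0.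
have m12 : measurable_fun [set: (T * T) * T] (fun q => q.1.2).
  exact: measurableT_comp measurable_snd measurable_fst.
have m11 : measurable_fun [set: (T * T) * T] (fun q => q.1.1).
  exact: measurableT_comp measurable_fst measurable_fst.
apply/measurable_EFinP; apply: measurable_funM; last exact: mw.
by apply: measurable_funX; apply: measurable_funB; exact: measurableT_comp.
Qed.

Let Jin0 u z x : (0 <= Jin u z x)%E.
Proof. by apply: integral_ge0 => y _; rewrite lee_fin mulr_ge0// sqr_ge0. Qed.

Let mJin_swap u : measurable_fun [set: T] u ->
  measurable_fun [set: T * T] (fun q => Jin u q.2 q.1).
Proof.
move=> mu_; have msw : measurable_fun [set: T * T] (fun q : T * T => (q.2, q.1)).
  exact: measurable_fun_pair.
exact: (measurableT_comp (mJin mu_) msw).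
Qed.

Let mJ u : measurable_fun [set: T] u -> measurable_fun [set: T] (J u).
Proof.
move=> mu_; apply: (@measurable_fun_section_integral _ _ _ _ _ mu G
  (fun q => Jin u q.2 q.1)) => //.
exact: mJin_swap.
Qed.

Let J0 u x : (0 <= J u x)%E.
Proof. by apply: integral_ge0 => z _; exact: Jin0. Qed.

Lemma kernel_sqnormWE u : measurable_fun [set: T] u ->
  sqW u = (\int[mu]_(x in O) Q u x + \int[mu]_(x in O) J u x)%E.
Proof.
move=> mu_; rewrite sqWE; congr (_ + _)%E.
  rewrite (@tonelli_on _ _ _ _ _ mu mu O G mO mG (fun q => (u q.2 ^+ 2 * p q.2 q.1)%:E)).
  - apply: eq_integral => y _; rewrite -ge0_integralZl_EFin ?sqr_ge0//.
    + by move=> x _; rewrite lee_fin.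
    + by apply/measurable_EFinP; apply: measurable_funTS; exact: mp.
  - apply/measurable_EFinP; apply: measurable_funM; last exact: mp.
    by apply: measurable_funX; exact: measurableT_comp.
  - by move=> x; rewrite lee_fin mulr_ge0// sqr_ge0.
(* On the right-hand side the integral over [O] is carried inward in two exchanges, past [z] and
   then past [y]. *)
rewrite (@tonelli_on _ _ _ _ _ mu mu O G mO mG (fun q => Jin u q.2 q.1)); last 2 first.
- exact: mJin_swap.
- by move=> x; exact: Jin0.
apply: eq_integral => z _ /=.
rewrite (@tonelli_on _ _ _ _ _ mu mu O G mO mG (fun q =>
  ((u q.2 - u z) ^+ 2 * (k (q.2, q.1) * k (z, q.1) / den q.1))%:E)); last 2 first.
- apply/measurable_EFinP; apply: measurable_funM; last exact: mw.
  by apply: measurable_funX; apply: measurable_funB => //; exact: measurableT_comp.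
- by move=> x; rewrite lee_fin mulr_ge0// sqr_ge0.
apply: eq_integral => y _ /=; rewrite -ge0_integralZl_EFin ?sqr_ge0//.
- by move=> x _; rewrite lee_fin.
- by apply/measurable_EFinP; apply: measurable_funTS; exact: mw.
Qed.

(** Each term integrates the square of an expression linear in [u] against a nonnegative weight; for
    the second term this is seen after writing it as one integral over the product space. *)
Lemma kernel_sqnormW_lincomb u v b :
  measurable_fun [set: T] u -> measurable_fun [set: T] v ->
  (sqW u < +oo)%E -> (sqW v < +oo)%E ->
  (sqW (fun x => b * u x + v x)%R < +oo)%E.
Proof.
move=> mu_ mv; rewrite !sqWE.
pose F (u : T -> R) (q : T * T) :=
  (((u q.2 - u q.1) ^+ 2)%:E * weight2 q.1 q.2)%E.
have mdiff (u' : T -> R) : measurable_fun [set: T] u' ->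
    measurable_fun [set: T * T] (fun q => u' q.2 - u' q.1).
  by move=> mu'; apply: measurable_funB; exact: measurableT_comp.
have FE (u' : T -> R) : measurable_fun [set: T] u' ->
    (\int[mu]_(z in G) \int[mu]_(y in G) (((u' y - u' z) ^+ 2)%:E * weight2 z y) =
    \int[mu \x mu]_(q in G `*` G) F u' q)%E.
  move=> mu'; rewrite -(tonelli_on1 mu mu mG mG)//.
    apply: emeasurable_funM => //; apply/measurable_EFinP.
    by apply: measurable_funX; exact: mdiff.
  by move=> q; rewrite mule_ge0// lee_fin sqr_ge0.
have A0 (u' : T -> R) : (0 <= \int[mu]_(y in G) ((u' y ^+ 2)%:E * weight y))%E.
  by apply: integral_ge0 => y _; rewrite mule_ge0// lee_fin sqr_ge0.
have B0 (u' : T -> R) : (0 <= \int[mu]_(z in G) \int[mu]_(y in G)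
    (((u' y - u' z) ^+ 2)%:E * weight2 z y))%E.
  apply: integral_ge0 => z _; apply: integral_ge0 => y _.
  by rewrite mule_ge0// lee_fin sqr_ge0.
move=> /(ge0_adde_lty (A0 u) (B0 u))[Au Bu] /(ge0_adde_lty (A0 v) (B0 v))[Av Bv].
apply: lte_add_pinfty; first exact: sqr_lincomb_integral_lty.
have mb : measurable_fun [set: T] (fun x => b * u x + v x).
  by apply: measurable_funD => //; exact: measurable_funM.
rewrite FE// /F; rewrite FE// in Bu; rewrite FE// in Bv.
under eq_integral => q _.
  rewrite (_ : _ - _ = b * (u q.2 - u q.1) + (v q.2 - v q.1)); last by ring.
  over.
apply: sqr_lincomb_integral_lty => //; [exact: measurableX|exact: mdiff..].
Qed.

Lemma kernel_sqnormV_lincomb u v b :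
  measurable_fun [set: T] u -> measurable_fun [set: T] v ->
  (sqV u < +oo)%E -> (sqV v < +oo)%E ->
  (sqV (fun x => b * u x + v x)%R < +oo)%E.
Proof.
move=> mu_ mv.
pose F (w : T -> R) (q : T * T) := (((w q.1 - w q.2) ^+ 2)%:E * (k (q.2, q.1))%:E)%E.
have mdiff (w : T -> R) : measurable_fun [set: T] w ->
    measurable_fun [set: T * T] (fun q => w q.1 - w q.2).
  by move=> mw'; apply: measurable_funB; exact: measurableT_comp.
have mks : measurable_fun [set: T * T] (fun q => (k (q.2, q.1))%:E).
  by apply/measurable_EFinP; exact: mkc.
have FE (w : T -> R) : measurable_fun [set: T] w ->
    (\int[mu]_(x in O) \int[mu]_y ((w x - w y) ^+ 2 * k (y, x))%:E =
    \int[mu \x mu]_(q in O `*` setT) F w q)%E.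
  move=> mw'; rewrite -(tonelli_on1 mu mu mO measurableT)//.
    apply: emeasurable_funM => //; apply/measurable_EFinP.
    by apply: measurable_funX; exact: mdiff.
  by move=> q; rewrite mule_ge0// lee_fin ?sqr_ge0.
have A0 (w : T -> R) : (0 <= \int[mu]_(y in O) (w y ^+ 2)%:E)%E.
  by apply: integral_ge0 => y _; rewrite lee_fin sqr_ge0.
have B0 (w : T -> R) : (0 <= \int[mu]_(x in O) \int[mu]_y
    ((w x - w y) ^+ 2 * k (y, x))%:E)%E.
  apply: integral_ge0 => z _; apply: integral_ge0 => y _.
  by rewrite lee_fin mulr_ge0// sqr_ge0.
have A1 (w : T -> R) : (\int[mu]_(y in O) (w y ^+ 2)%:E =
    \int[mu]_(y in O) ((w y ^+ 2)%:E * cst 1 y))%E.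
  by apply: eq_integral => y _; rewrite mule1.
move=> /(ge0_adde_lty (A0 u) (B0 u))[Au Bu] /(ge0_adde_lty (A0 v) (B0 v))[Av Bv].
rewrite A1 in Au; rewrite A1 in Av.
apply: lte_add_pinfty; first by rewrite A1; exact: sqr_lincomb_integral_lty.
have mb : measurable_fun [set: T] (fun x => b * u x + v x).
  by apply: measurable_funD => //; exact: measurable_funM.
rewrite FE// /F; rewrite FE// in Bu; rewrite FE// in Bv.
under eq_integral => q _.
  rewrite (_ : _ - _ = b * (u q.1 - u q.2) + (v q.1 - v q.2)); last by ring.
  over.
apply: sqr_lincomb_integral_lty => //; first exact: measurableX.
- exact: mdiff.
- exact: mdiff.
- by move=> q; rewrite lee_fin.
Qed.

(** The real-valued integral is [fine] of the difference of the integrals of the positive and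
    negative parts, at every point; each of these is measurable in [x] by Tonelli's theorem. *)
Lemma measurable_kernel_ext u :
  measurable_fun [set: T] u -> measurable_fun [set: T] (ext u).
Proof.
move=> mu_; pose F q := (u q.2 * p q.2 q.1)%:E.
have mF : measurable_fun [set: T * T] F.
  by apply/measurable_EFinP; apply: measurable_funM; [exact: measurableT_comp|exact: mp].
rewrite (_ : ext u = fine \o (fun x =>
    \int[mu]_(y in G) F^\+ (x, y) - \int[mu]_(y in G) F^\- (x, y))%E).
  apply: (measurableT_comp (fine_measurable measurableT)).
  apply: emeasurable_funB; apply: measurable_fun_section_integral => //.
  - exact: measurable_funepos.
  - exact: measurable_funeneg.
apply/funext => x; rewrite /ext /Rintegral integralE/=.
congr (fine (_ - _)); apply: eq_integral => y _.
  by rewrite !funeposE.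
by rewrite !funenegE.
Qed.

Hypothesis mass_lty : \forall x \ae mu, O x -> (mass x < +oo)%E.
Variable a : R.
Hypotheses (a0 : 0 < a) (den_ge : \forall x \ae mu, O x -> a <= den x).

Let sqnormW_lty u : measurable_fun [set: T] u -> (sqW u < +oo)%E ->
  \forall x \ae mu, O x -> (Q u x < +oo)%E.
Proof.
move=> mu_; rewrite kernel_sqnormWE// => Woo; apply: ae_integral_lty => //.
  exact: mQ.
by apply: le_lt_trans Woo; rewrite leeDl//; exact: integral_ge0.
Qed.

Let mks x : measurable_fun [set: T] (fun y => k (y, x)).
Proof. exact: mkc. Qed.

(** Makes the integral defining E(u) a convergent one almost everywhere, on which the additivity of
    E rests. *)
Lemma kernel_ext_integrable u :
  measurable_fun [set: T] u -> (sqW u < +oo)%E ->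
  \forall x \ae mu, O x ->
    mu.-integrable G (fun y => (u y * (k (y, x) / den x))%:E).
Proof.
move=> mu_ /(sqnormW_lty mu_).
apply: filterS3 mass_lty den_ge => x mx dx qx Ox.
exact: (section_integrable mG (mks x) (fun y => k0 (y, x)) (mx Ox)
  (lt_le_trans a0 (dx Ox)) mu_ (qx Ox)).
Qed.

Lemma kernel_ext_bound u :
  measurable_fun [set: T] u -> (sqW u < +oo)%E ->
  (\int[mu]_(x in O) (ext u x ^+ 2)%:E +
   \int[mu]_(x in O) \int[mu]_(y in G) ((ext u x - u y) ^+ 2 * k (y, x))%:E
   <= (1 + c)%:E * sqW u)%E.
Proof.
move=> mu_ Woo; have Qoo := sqnormW_lty mu_ Woo; rewrite kernel_sqnormWE//.
have mQu := mQ mu_; have mJu := mJ mu_.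
apply: (@le_trans _ _ (\int[mu]_(x in O) Q u x +
    \int[mu]_(x in O) (c%:E * Q u x + J u x))%E).
  apply: leeD.
    apply: ge0_ae_le_integral => // [x _|]; first by rewrite lee_fin sqr_ge0.
    apply: filterS3 mass_lty den_ge Qoo => x mx dx qx Ox.
    exact: (section_mean_sqr_le mG (mks x) (fun y => k0 (y, x)) c0 (mx Ox)
      (lt_le_trans a0 (dx Ox)) mu_ (qx Ox)).
  apply: ge0_ae_le_integral => [x _|x _|].
  - by apply: integral_ge0 => y _; rewrite lee_fin mulr_ge0// sqr_ge0.
  - by rewrite adde_ge0// mule_ge0.
  - apply: filterS3 mass_lty den_ge Qoo => x mx dx qx Ox.
    exact: (section_extension_energy mG (mks x) (fun y => k0 (y, x)) c0 (mx Ox)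
      (lt_le_trans a0 (dx Ox)) mu_ (qx Ox)).
have mQO : measurable_fun O (Q u) by exact: measurable_funTS.
have mcQ : measurable_fun O (fun x => c%:E * Q u x)%E by exact: emeasurable_funM.
have mJO : measurable_fun O (J u) by exact: measurable_funTS.
have cQ0 x : O x -> (0 <= c%:E * Q u x)%E by move=> _; rewrite mule_ge0.
have -> : (\int[mu]_(x in O) (c%:E * Q u x + J u x) =
    c%:E * \int[mu]_(x in O) Q u x + \int[mu]_(x in O) J u x)%E.
  by rewrite -ge0_integralZl_EFin// -ge0_integralD.
by apply: extension_const_le => //; apply: integral_ge0.
Qed.

Lemma kernel_trace_bound u : measurable_fun [set: T] u ->
  (sqW u <= (2 / a + 2)%:E * sqV u)%E.
Proof.
move=> mu_; rewrite kernel_sqnormWE// /kernel_sqnormV.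
pose I := (\int[mu]_(x in O) \int[mu]_y ((u x - u y) ^+ 2 * k (y, x))%:E)%E.
set U := integral _ O (fun x => (u x ^+ 2)%:E); rewrite -/I.
(* The estimates at fixed [x] see only the energy with [y] in [G]; it is enlarged to the whole space
   when the constants are collected. *)
pose I' x := (\int[mu]_(y in G) ((u x - u y) ^+ 2 * k (y, x))%:E)%E.
have mI' : measurable_fun [set: T] I'.
  apply: (@measurable_fun_section_integral _ _ _ _ _ mu G
    (fun q => ((u q.1 - u q.2) ^+ 2 * k (q.2, q.1))%:E)) => //; last first.
    by move=> x; rewrite lee_fin mulr_ge0// sqr_ge0.
  apply/measurable_EFinP; apply: measurable_funM; last exact: mkc.
  by apply: measurable_funX; apply: measurable_funB; exact: measurableT_comp.
have I'0 x : (0 <= I' x)%E.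
  by apply: integral_ge0 => y _; rewrite lee_fin mulr_ge0// sqr_ge0.
have mU : measurable_fun [set: T] (fun x => (u x ^+ 2)%:E).
  by apply/measurable_EFinP; exact: measurable_funX.
have mI'O : measurable_fun O I' by exact: measurable_funTS.
have mUO : measurable_fun O (fun x => (u x ^+ 2)%:E) by exact: measurable_funTS.
have mI'2 : measurable_fun O (fun x => (2 / a)%:E * I' x)%E by exact: emeasurable_funM.
have mU2 : measurable_fun O (fun x => 2%:E * (u x ^+ 2)%:E)%E.
  exact: emeasurable_funM.
have u0 x : O x -> (0 <= (u x ^+ 2)%:E)%E by move=> _; rewrite lee_fin sqr_ge0.
have da0 : 0 <= 2 / a by rewrite divr_ge0// ltW.
have I'20 x : O x -> (0 <= (2 / a)%:E * I' x)%E by move=> _; rewrite mule_ge0.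
have u20 x : O x -> (0 <= 2%:E * (u x ^+ 2)%:E)%E.
  by move=> Ox; rewrite mule_ge0// u0.
have U0 : (0 <= U)%E by apply: integral_ge0 => x _; rewrite lee_fin sqr_ge0.
have I'I : (\int[mu]_(x in O) I' x <= I)%E.
  apply: ge0_le_integral_lower => x _; first exact: I'0.
  apply: ge0_integral_subset => // y _.
  by rewrite lee_fin mulr_ge0// sqr_ge0.
have II0 : (0 <= \int[mu]_(x in O) I' x)%E.
  by apply: integral_ge0 => x _; exact: I'0.
apply: (@le_trans _ _ (((2 / a)%:E * \int[mu]_(x in O) I' x + 2%:E * U) +
    2%:E * \int[mu]_(x in O) I' x)%E).
  apply: leeD.
    rewrite -!ge0_integralZl_EFin// -ge0_integralD//.
    apply: ge0_ae_le_integral => // [x _|].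
      by rewrite adde_ge0// mule_ge0// lee_fin sqr_ge0.
    apply: filterS2 mass_lty den_ge => x mx dx Ox.
    rewrite -EFinM.
    exact: (section_trace_weight mG (mks x) (fun y => k0 (y, x)) c0 (mx Ox)
        (lt_le_trans a0 (dx Ox)) (u x) a0 (dx Ox) mu_).
  rewrite -ge0_integralZl_EFin//.
  apply: ge0_ae_le_integral => // [x _|]; first by rewrite mule_ge0.
  apply: filterS2 mass_lty den_ge => x mx dx Ox.
  exact: (section_trace_energy mG (mks x) (fun y => k0 (y, x)) c0 (mx Ox)
    (lt_le_trans a0 (dx Ox)) (u x) mu_).
exact: trace_const_le.
Qed.

(** The energy of the glued function splits according to the place of [y]: in [O] it is finite by
    hypothesis, in [G] by the extension bound, and elsewhere [k] vanishes almost everywhere. *)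
Lemma kernel_ext_lty u :
  O `&` G = set0 ->
  (\forall y \ae mu, ~ (O `|` G) y -> \int[mu]_(x in O) (k (y, x))%:E = 0)%E ->
  measurable_fun [set: T] u -> (sqW u < +oo)%E ->
  (\int[mu]_(x in O) \int[mu]_(y in O) ((ext u x - ext u y) ^+ 2 * k (y, x))%:E
     < +oo)%E ->
  (sqV (fun x => (ext u \_ O) x + (u \_ G) x)%R < +oo)%E.
Proof.
move=> OG rest mu_ Woo OOoo; set v := (X in sqV X).
have vO x : O x -> v x = ext u x.
  move=> Ox; rewrite /v !patchE mem_set// memNset ?addr0// => Gx.
  by rewrite -[False]/(set0 x) -OG.
have vG x : G x -> v x = u x.
  move=> Gx; rewrite /v !patchE (mem_set Gx) memNset ?add0r// => Ox.
  by rewrite -[False]/(set0 x) -OG.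
have mE := measurable_kernel_ext mu_.
have mv : measurable_fun [set: T] v.
  apply: measurable_funD.
    by apply/(measurable_restrictT (ext u)) => //; exact: measurable_funTS.
  by apply/(measurable_restrictT u) => //; exact: measurable_funTS.
pose F x y := ((v x - v y) ^+ 2 * k (y, x))%:E.
have F0 x y : (0 <= F x y)%E by rewrite lee_fin mulr_ge0// sqr_ge0.
have mF : measurable_fun [set: T * T] (fun q => F q.1 q.2).
  apply/measurable_EFinP; apply: measurable_funM; last exact: mkc.
  by apply: measurable_funX; apply: measurable_funB; exact: measurableT_comp.
have mFx x : measurable_fun [set: T] (F x).
  apply/measurable_EFinP; apply: measurable_funM => //.
  by apply: measurable_funX; exact: measurable_funB.
have mOG : measurable (O `|` G) by exact: measurableU.
have mR := measurableC mOG.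
have restE : \forall x \ae mu, O x ->
    (\int[mu]_y F x y = \int[mu]_(y in O) F x y + \int[mu]_(y in G) F x y)%E.
  have mkx : measurable_fun [set: T * T] (fun q => (k (q.2, q.1))%:E).
    by apply/measurable_EFinP; exact: mkc.
  have k00 (q : T * T) : (0 <= (k (q.2, q.1))%:E)%E by rewrite lee_fin.
  (* The hypothesis speaks of almost every [y], with [x] integrated; Tonelli's theorem turns it into
     a statement for almost every [x], with [y] integrated. *)
  have I0 : (\int[mu]_(x in O) \int[mu]_(y in ~` (O `|` G)) (k (y, x))%:E = 0)%E.
    rewrite (tonelli_on _ _ mO mR mkx k00).
    rewrite (@ae_eq_integral_lower _ _ _ _ _ _ (cst 0%E)) ?integral0//.
  have mI : measurable_fun [set: T]
      (fun x => \int[mu]_(y in ~` (O `|` G)) (k (y, x))%:E)%E.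
    exact: (measurable_fun_section_integral mu mR mkx k00).
  have := ge0_integral_eq0_ae mO mI _ I0.
  move=> /(_ (fun x => integral_ge0 _ (fun y _ => k00 (x, y)))).
  apply: filterS => x Rx Ox.
  rewrite -ge0_integral_setU//; last 2 first.
  - exact: measurable_funTS.
  - by apply/disj_setPS; rewrite OG.
  rewrite [RHS]integral_mkcond; apply: ae_eq_integral_lower.
  have mkx1 : measurable_fun [set: T] (fun y => (k (y, x))%:E) by apply/measurable_EFinP.
  have := ge0_integral_eq0_ae mR mkx1 (fun y => k00 (x, y)) (Rx Ox).
  apply: filterS => y ky _; rewrite patchE; case: ifPn => //.
  by rewrite notin_setE => /ky [ky0]; rewrite /F ky0 mulr0.
have Boo : ((1 + c)%:E * sqW u < +oo)%E.
  by rewrite lte_mul_pinfty// lee_fin addr_ge0.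
have /ge0_adde_lty[||Eoo EGoo] := le_lt_trans (kernel_ext_bound mu_ Woo) Boo.
- by apply: integral_ge0 => x _; rewrite lee_fin sqr_ge0.
- apply: integral_ge0 => x _; apply: integral_ge0 => y _.
  by rewrite lee_fin mulr_ge0// sqr_ge0.
apply: lte_add_pinfty.
  rewrite (eq_integral (fun x => (ext u x ^+ 2)%:E))// => x /set_mem Ox.
  by rewrite vO.
rewrite (ae_eq_integral_lower restE) ge0_integralD//; last 4 first.
- by move=> x _; exact: integral_ge0.
- apply: measurable_funTS.
  by apply: (measurable_fun_section_integral mu mO mF) => q; exact: F0.
- by move=> x _; exact: integral_ge0.
- apply: measurable_funTS.
  by apply: (measurable_fun_section_integral mu mG mF) => q; exact: F0.
apply: lte_add_pinfty.
  apply: le_lt_trans OOoo; rewrite le_eqVlt; apply/orP; left; apply/eqP.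
  apply: eq_integral => x /set_mem Ox; apply: eq_integral => y /set_mem Oy.
  by rewrite /F !vO.
apply: le_lt_trans EGoo; rewrite le_eqVlt; apply/orP; left; apply/eqP.
apply: eq_integral => x /set_mem Ox; apply: eq_integral => y /set_mem Gy.
by rewrite /F vO// vG.
Qed.

End nonlocal_trace.

(** * Back to Lebesgue measurable kernels *)

(** Tonelli's theorem asks for a sigma-finite structure, whereas [lebesgue] is typed as a measure
    only. The same set function is repackaged, so integrals against both are convertible. *)
Definition lebesgue_sf (R : realType) d :
    {sigma_finite_measure set (lebesgueRn R d) -> \bar R} :=
  HB.pack_for {sigma_finite_measure set (lebesgueRn R d) -> \bar R}
    (Measure.sort (lebesgue R d))
    (@Measure_isSigmaFinite.Build _ _ _ (lebesgue R d) (lebesgue_sigma_finite R d)).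

Lemma measurable_lincomb d (T : measurableType d) (R : realType) (D : set T) (b : R)
    (u v : T -> R) : measurable_fun D u -> measurable_fun D v ->
  measurable_fun D (fun x => b * u x + v x).
Proof. by move=> mu mv; apply: measurable_funD => //; exact: measurable_funM. Qed.

(** Completeness carries measurability along an almost everywhere equality. *)
Lemma ae_eq_integrable_complete d (T : measurableType d) (R : realType)
    (mu : {measure set T -> \bar R}) (D : set T) (f g : T -> \bar R) :
  measure_is_complete mu -> (\forall x \ae mu, D x -> f x = g x) ->
  mu.-integrable D f -> mu.-integrable D g.
Proof.
move=> cmu fg /integrableP[mf foo]; apply/integrableP; split.
  by apply: (ae_measurable_fun cmu _ mf); exact: fg.
rewrite (_ : (\int[mu]_(x in D) `|g x| = \int[mu]_(x in D) `|f x|)%E)//.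
by apply: ae_eq_integral_lower; apply: filterS fg => x fg /fg ->.
Qed.

Section transfer.
Variables (R : realType) (d : nat) (Omega : set 'rV[R]_d).
Variables (gamma : 'rV[R]_d -> 'rV[R]_d -> R) (c : R).
Local Notation L := (lebesgueRn R d).
Local Notation mu := (lebesgue R d).
Local Notation G := (Gamma Omega gamma).
Hypotheses (oO : open Omega) (gamma0 : forall y x, 0 <= gamma y x).
Hypothesis c0 : 0 <= c.
Variable k : L * L -> R.
Hypotheses (mk : measurable_fun [set: L * L] k) (k0 : forall q, 0 <= k q).
Hypothesis gkx : \forall x \ae mu, \forall y \ae mu, gamma y x = k (y, x).
Hypothesis gky : \forall y \ae mu, \forall x \ae mu, gamma y x = k (y, x).

Let mO : measurable (Omega : set L).
Proof. by apply: measurable_completion; exact: open_measurable_borelRn. Qed.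

Let mass x := (\int[mu]_(y in G) (k (y, x))%:E)%E.
Let den x := fine (mass x) + c.

Let massE : \forall x \ae mu, massGamma Omega gamma x = mass x.
Proof.
apply: filterS gkx => x gx; apply: ae_eq_integral_lower.
by apply: filterS gx => y ->.
Qed.

Let denE : \forall x \ae mu, denom Omega gamma c x = den x.
Proof. by apply: filterS massE => x mx; rewrite /denom mx. Qed.

Let massO y := (\int[mu]_(x in Omega) (k (y, x))%:E)%E.

Let massOE : \forall y \ae mu, (\int[mu]_(x in Omega) (gamma y x)%:E = massO y)%E.
Proof.
apply: filterS gky => y gy; apply: ae_eq_integral_lower.
by apply: filterS gy => x ->.
Qed.

Let mmassO : measurable_fun [set: L] massO.
Proof.
apply: (measurable_fun_section_integral (lebesgue_sf R d) mO (F := fun q => (k q)%:E)).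
  exact/measurable_EFinP.
by move=> x; rewrite lee_fin.
Qed.

(** The integral of [gamma y] over Omega agrees for almost every [y] with that of [k], which is
    measurable in [y]; completeness transfers this to [gamma]. *)
Lemma measurable_Gamma : measurable (G : set L).
Proof.
have mg : measurable_fun [set: L]
    (fun y : L => \int[mu]_(x in Omega) (gamma y x)%:E)%E.
  apply: ae_measurable_fun mmassO; first exact: lebesgue_complete.
  by apply: filterS massOE => y + _ => ->.
rewrite (_ : G = ~` (Omega : set L) `&` ([set: L] `&`
    [set y | 0 < (fun y : L => \int[mu]_(x in Omega) (gamma y x)%:E) y]%E)).
  by apply: measurableI; [exact: measurableC|exact: emeasurable_fun_o_infty].
by rewrite setTI.
Qed.

Lemma Omega_Gamma_disjoint : Omega `&` G = set0.
Proof. by rewrite -subset0 => x [Ox []]. Qed.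

Let rest : \forall y \ae mu, ~ (Omega `|` G) y ->
  (\int[mu]_(x in Omega) (k (y, x))%:E = 0)%E.
Proof.
apply: filterS massOE => y gy /not_orP[Oy Gy].
rewrite -[LHS]/(massO y) -gy; apply/eqP; rewrite eq_le integral_ge0 ?andbT.
  by rewrite leNgt; apply/negP => g0; exact: Gy.
by move=> x _; rewrite lee_fin.
Qed.

Let KW u := kernel_sqnormW mu (Omega : set L) G k den u.
Let KV u := kernel_sqnormV mu (Omega : set L) k u.

Lemma sqnormW_kernel u : sqnormW Omega gamma c u = KW u.
Proof.
have EA : (\int[mu]_(y in G) ((u y ^+ 2)%:E * weight Omega gamma c y) =
    \int[mu]_(y in G) ((u y ^+ 2)%:E * \int[mu]_(x in Omega) (k (y, x) / den x)%:E))%E.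
  apply: ae_eq_integral_lower; apply: filterS gky => y gy _.
  suff -> : weight Omega gamma c y = (\int[mu]_(x in Omega) (k (y, x) / den x)%:E)%E by [].
  apply: ae_eq_integral_lower; apply: filterS2 gy denE => x gyx dx _.
  by rewrite gyx dx.
rewrite /sqnormW EA; apply: (f_equal (adde _)).
apply: ae_eq_integral_lower; apply: filterS gky => z gz _.
apply: ae_eq_integral_lower; apply: filterS gky => y gy _.
apply: (f_equal (mule _)).
apply: ae_eq_integral_lower; apply: filterS3 gz gy denE => x gzx gyx dx _.
by rewrite gzx gyx dx.
Qed.

Lemma sqnormV_kernel u : sqnormV Omega gamma u = KV u.
Proof.
apply: (f_equal (adde _)).
apply: ae_eq_integral_lower; apply: filterS gkx => x gx _.
by apply: ae_eq_integral_lower; apply: filterS gx => y gyx _; rewrite gyx.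
Qed.

Let ext u x := \int[mu]_(y in G) (u y * (k (y, x) / den x)).

Lemma extE_kernel u : \forall x \ae mu, extE Omega gamma c u x = ext u x.
Proof.
apply: filterS2 gkx denE => x gx dx; apply: (f_equal fine).
by apply: ae_eq_integral_lower; apply: filterS gx => y -> _; rewrite dx.
Qed.

(** Elements of W are measurable on Gamma only, while the kernel estimates ask for functions
    measurable on the whole space; this permits passing to the extension by zero. *)
Lemma sqnormW_eq u v : (forall y, G y -> u y = v y) ->
  sqnormW Omega gamma c u = sqnormW Omega gamma c v.
Proof.
move=> uv; rewrite /sqnormW.
rewrite (eq_integral (fun y : L => (v y ^+ 2)%:E * weight Omega gamma c y)%E); last first.
  by move=> y /set_mem /uv ->.
apply: (f_equal (adde _)).
apply: eq_integral => z /set_mem /uv uz; apply: eq_integral => y /set_mem /uv uy.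
by rewrite uy uz.
Qed.

Lemma extE_eq u v : (forall y, G y -> u y = v y) ->
  extE Omega gamma c u = extE Omega gamma c v.
Proof.
move=> uv; apply/funext => x; apply: (f_equal fine).
by apply: eq_integral => y /set_mem /uv ->.
Qed.

Let mG := measurable_Gamma.

Let mext u : lebesgue_measurable_fun G u -> measurable_fun [set: L] (u \_ G : L -> R).
Proof. by move=> mu_; exact: ((measurable_restrictT (u : L -> R) mG).1 mu_). Qed.

Let restrictE (u : 'rV[R]_d -> R) y : G y -> (u \_ G) y = u y.
Proof. by move=> Gy; rewrite patchE mem_set. Qed.

Lemma linear_subspaceV : linear_subspace (spaceV Omega gamma).
Proof.
split=> [|b u v].
  split; first exact: measurable_cst.
  have -> : sqnormV Omega gamma (fun=> 0) = 0%E; last exact: ltry.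
  rewrite /sqnormV integral0_eq ?add0e => [|x _]; last by rewrite expr0n.
  apply: integral0_eq => x _; apply: integral0_eq => y _.
  by rewrite subrr expr0n mul0r.
move=> [mu_ uoo] [mv voo]; split.
  exact: measurable_lincomb.
rewrite sqnormV_kernel; rewrite sqnormV_kernel in uoo; rewrite sqnormV_kernel in voo.
exact: (kernel_sqnormV_lincomb (mu := lebesgue_sf R d) mO mk k0 b mu_ mv uoo voo).
Qed.

Lemma linear_subspaceW : linear_subspace (spaceW Omega gamma c).
Proof.
split=> [|b u v].
  split; first exact: measurable_cst.
  have -> : sqnormW Omega gamma c (fun=> 0) = 0%E; last exact: ltry.
  rewrite /sqnormW integral0_eq ?add0e => [|x _]; last by rewrite expr0n mul0e.
  apply: integral0_eq => x _; apply: integral0_eq => y _.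
  by rewrite subrr expr0n mul0e.
move=> [mu_ uoo] [mv voo]; split.
  exact: measurable_lincomb.
rewrite (@sqnormW_eq _ (fun x => b * (u \_ G) x + (v \_ G) x)); last first.
  by move=> y Gy; rewrite !restrictE.
rewrite -(sqnormW_eq (@restrictE u)) in uoo.
rewrite -(sqnormW_eq (@restrictE v)) in voo.
rewrite sqnormW_kernel; rewrite sqnormW_kernel in uoo; rewrite sqnormW_kernel in voo.
exact: (kernel_sqnormW_lincomb (mu := lebesgue_sf R d) mO mG mk k0 c0 b
  (mext mu_) (mext mv) uoo voo).
Qed.

Hypothesis mass_lty :
  \forall x \ae mu, Omega x -> (massGamma Omega gamma x < +oo)%E.
Variable a : R.
Hypothesis a0 : 0 < a.
Hypothesis den_ge : \forall x \ae mu, Omega x -> a <= denom Omega gamma c x.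

Let mass_lty' : \forall x \ae mu, Omega x -> (mass x < +oo)%E.
Proof. by apply: filterS2 mass_lty massE => x mx <-. Qed.

Let den_ge' : \forall x \ae mu, Omega x -> a <= den x.
Proof. by apply: filterS2 den_ge denE => x mx <-. Qed.

Lemma trace_bound u : spaceV Omega gamma u ->
  (sqnormW Omega gamma c (Tr Omega gamma u) <=
   (2 / a + 2)%:E * sqnormV Omega gamma u)%E.
Proof.
move=> [mu_ uoo]; rewrite (sqnormW_eq (@restrictE u)) sqnormW_kernel sqnormV_kernel.
exact: (kernel_trace_bound (mu := lebesgue_sf R d) mO mG mk k0 c0
  mass_lty' a0 den_ge' mu_).
Qed.

Lemma ext_integrable v : spaceW Omega gamma c v ->
  \forall x \ae mu, Omega x -> mu.-integrable G
    (fun y => (v y * (gamma y x / denom Omega gamma c x))%:E).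
Proof.
move=> [mv voo]; rewrite -(sqnormW_eq (@restrictE v)) sqnormW_kernel in voo.
have := kernel_ext_integrable (mu := lebesgue_sf R d) mO mG mk k0 c0
  mass_lty' a0 den_ge' (mext mv) voo.
move=> /(filterS3 _) /(_ gkx denE); apply => x ix gx dx Ox.
apply: ae_eq_integrable_complete (ix Ox); first exact: lebesgue_complete.
by apply: filterS gx => y gyx Gy; rewrite gyx dx restrictE.
Qed.

Let ext_restrictE v : \forall x \ae mu, extE Omega gamma c v x = ext (v \_ G) x.
Proof. by rewrite -(extE_eq (@restrictE v)); exact: extE_kernel. Qed.

Lemma ext_bound v : spaceW Omega gamma c v ->
  (sqnormL2 Omega (extE Omega gamma c v) +
   \int[mu]_(x in Omega) \int[mu]_(y in G)
     ((extE Omega gamma c v x - v y) ^+ 2 * gamma y x)%:E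
   <= (1 + c)%:E * sqnormW Omega gamma c v)%E.
Proof.
move=> [mv]; rewrite -(sqnormW_eq (@restrictE v)) sqnormW_kernel => voo.
have EA : sqnormL2 Omega (extE Omega gamma c v) =
    (\int[mu]_(x in Omega) (ext (v \_ G) x ^+ 2)%:E)%E.
  by apply: ae_eq_integral_lower; apply: filterS (ext_restrictE v) => x ->.
have EB : (\int[mu]_(x in Omega) \int[mu]_(y in G)
     ((extE Omega gamma c v x - v y) ^+ 2 * gamma y x)%:E =
   \int[mu]_(x in Omega) \int[mu]_(y in G)
     ((ext (v \_ G) x - (v \_ G) y) ^+ 2 * k (y, x))%:E)%E.
  apply: ae_eq_integral_lower; apply: filterS2 gkx (ext_restrictE v) => x gx -> _.
  by apply: ae_eq_integral_lower; apply: filterS gx => y -> Gy; rewrite restrictE.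
rewrite EA EB.
exact: (kernel_ext_bound (mu := lebesgue_sf R d) mO mG mk k0 c0
  mass_lty' a0 den_ge' (mext mv) voo).
Qed.

Lemma measurable_extE v : spaceW Omega gamma c v ->
  lebesgue_measurable_fun Omega (extE Omega gamma c v).
Proof.
move=> [mv _].
have mE : measurable_fun (Omega : set L) (EFin \o (ext (v \_ G) : L -> R)).
  apply/measurable_EFinP; apply: measurable_funTS.
  exact: (measurable_kernel_ext (lebesgue_sf R d) mG mk k0 c0 (mext mv)).
suff : measurable_fun (Omega : set L) (EFin \o (extE Omega gamma c v : L -> R)).
  by move/measurable_EFinP.
apply: ae_measurable_fun mE; first exact: lebesgue_complete.
by apply: filterS (ext_restrictE v) => x /= ->.
Qed.

Lemma Tr_surjective u : spaceW Omega gamma c u ->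
  (\int[mu]_(x in Omega) \int[mu]_(y in Omega)
     ((extE Omega gamma c u x - extE Omega gamma c u y) ^+ 2 * gamma y x)%:E
   < +oo)%E ->
  exists2 v, spaceV Omega gamma v & eqW Omega gamma (Tr Omega gamma v) u.
Proof.
move=> [mu_]; rewrite -(sqnormW_eq (@restrictE u)) sqnormW_kernel => uoo.
rewrite (_ : integral _ _ _ = \int[mu]_(x in Omega) \int[mu]_(y in Omega)
    ((ext (u \_ G) x - ext (u \_ G) y) ^+ 2 * k (y, x))%:E)%E; last first.
  apply: ae_eq_integral_lower; apply: filterS2 gkx (ext_restrictE u) => x gx -> _.
  apply: ae_eq_integral_lower.
  by apply: filterS2 gx (ext_restrictE u) => y -> ->.
move=> OOoo; set u' : L -> R := u \_ G in uoo OOoo.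
have mu' : measurable_fun [set: L] u' by exact: mext.
(* Built from the kernel version [ext] of the extension, so that the estimates for [k] apply to it
   as it stands. *)
exists (fun x => (ext u' \_ Omega) x + (u' \_ G) x).
  split.
    have mE := measurable_kernel_ext (lebesgue_sf R d) mG mk k0 c0 mu'.
    apply: measurable_funD.
      apply: ((measurable_restrictT (ext u' : L -> R) mO).1 _).
      exact: measurable_funTS.
    apply: ((measurable_restrictT (u' : L -> R) mG).1 _).
    exact: measurable_funTS.
  rewrite sqnormV_kernel.
  exact: (kernel_ext_lty (mu := lebesgue_sf R d) mO mG mk k0 c0 mass_lty' a0
    den_ge' Omega_Gamma_disjoint rest mu' uoo OOoo).
apply: aeW => x Gx; rewrite /Tr restrictE// /u' !patchE (mem_set Gx) memNset ?add0r//.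
by move=> Ox; rewrite -[False]/(set0 x) -Omega_Gamma_disjoint.
Qed.

End transfer.

(** * Positive lower bound of the denominator, and assembly of the three assertions *)

(** The essential infimum is a supremum of almost everywhere lower bounds [m]. Were [m + c <= 0] for
    all of them, it would be at most [- c]; hence some [m] has [m + c > 0], and a real such [m]
    gives [a = m + c]. *)
Lemma denom_lower_bound (R : realType) d (Omega : set 'rV[R]_d)
    (gamma : 'rV[R]_d -> 'rV[R]_d -> R) (c : R) :
  (\forall x \ae lebesgue R d, Omega x -> (massGamma Omega gamma x < +oo)%E) ->
  (forall y x, 0 <= gamma y x) ->
  (0 < ess_inf_on Omega (massGamma Omega gamma) + c%:E)%E ->
  exists2 a : R, 0 < a &
    \forall x \ae lebesgue R d, Omega x -> a <= denom Omega gamma c x.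
Proof.
move=> moo g0 inf0.
have [m mle mc] : exists2 m : \bar R,
    (\forall x \ae lebesgue R d, Omega x -> (m <= massGamma Omega gamma x)%E) &
    (0 < m + c%:E)%E.
  apply: contrapT => H; move: inf0; apply/negP; rewrite -leNgt.
  have : (ess_inf_on Omega (massGamma Omega gamma) <= (- c)%:E)%E.
    apply: ge_ereal_sup => m mle; rewrite leNgt; apply/negP => cm; apply: H.
    exists m => //; case: m cm {mle} => [r| |//]; last by rewrite addye.
    by rewrite lte_fin -EFinD lte_fin -subr_gt0 opprK.
  by move=> /(leeD2r c%:E) /le_trans; apply; rewrite -EFinD addNr.
have mass0 x : (0 <= massGamma Omega gamma x)%E.
  by apply: integral_ge0 => y _; rewrite lee_fin.
case: m mle mc => [r| |//] mle mc.
  exists (r + c); first by rewrite -lte_fin EFinD.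
  apply: filterS2 moo mle => x xoo rx Ox; rewrite /denom lerD2r -lee_fin fineK ?rx//.
  by rewrite ge0_fin_numE// xoo.
(* The case [m = +oo] contradicts the finiteness of the mass at almost every point of Omega, so any
   positive number does. *)
exists 1 => //; apply: filterS2 moo mle => x xoo rx Ox.
by have := le_lt_trans (rx Ox) (xoo Ox).
Qed.

Theorem theorem5p4 (R : realType) (d : nat) (Omega : set 'rV[R]_d)
    (gamma : 'rV[R]_d -> 'rV[R]_d -> R) (c : R) :
  bounded_set Omega -> Omega !=set0 -> open Omega ->
  (forall y x, 0 <= gamma y x) ->
  lebesgue_measurable_fun setT
    (fun z : 'rV[R]_(d + d) => gamma (lsubmx z) (rsubmx z)) ->
  (\forall x \ae lebesgue R d, Omega x -> (massGamma Omega gamma x < +oo)%E) ->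
  0 <= c ->
  (0 < ess_inf_on Omega (massGamma Omega gamma) + c%:E)%E ->
  [/\ (* (i) *)
      linear_operator (spaceV Omega gamma) (eqV Omega gamma)
        (spaceW Omega gamma c) (eqW Omega gamma) (Tr Omega gamma) /\
      (exists2 C : R, 0 < C & forall u, spaceV Omega gamma u ->
        (normW Omega gamma c (Tr Omega gamma u)
           <= C%:E * normV Omega gamma u)%E),
      (* (ii) *)
      [/\ forall v, spaceW Omega gamma c v ->
            \forall x \ae lebesgue R d, Omega x ->
              (lebesgue R d).-integrable (Gamma Omega gamma)
                (fun y => (v y * (gamma y x / denom Omega gamma c x))%:E),
          linear_operator (spaceW Omega gamma c) (eqW Omega gamma)
            (spaceL2 Omega) (eq_ae_on Omega) (extE Omega gamma c) &
          exists2 C : R, 0 < C & forall v, spaceW Omega gamma c v ->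
            (sqnormL2 Omega (extE Omega gamma c v) +
             \int[lebesgue R d]_(x in Omega)
               \int[lebesgue R d]_(y in Gamma Omega gamma)
                 ((extE Omega gamma c v x - v y) ^+ 2 * gamma y x)%:E
             <= C%:E * sqnormW Omega gamma c v)%E] &
      (* (iii) *)
      (exists2 C : R, 0 < C & forall v, spaceW Omega gamma c v ->
        (\int[lebesgue R d]_(x in Omega) \int[lebesgue R d]_(y in Omega)
           ((extE Omega gamma c v x - extE Omega gamma c v y) ^+ 2
              * gamma y x)%:E
         <= C%:E * sqnormW Omega gamma c v)%E) ->
      forall u, spaceW Omega gamma c u ->
        exists2 v, spaceV Omega gamma v &
          eqW Omega gamma (Tr Omega gamma v) u].
Proof.
move=> _ _ oO g0 mgamma moo c0 /(denom_lower_bound moo g0)[a a0 dena].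
have [k [mk k0 gkx gky]] := lebesgue_kernel g0 mgamma.
have mG := measurable_Gamma oO mk k0 gky.
have subW := linear_subspaceW oO c0 mk k0 gkx gky.
have trW := trace_bound oO c0 mk k0 gkx gky moo a0 dena.
have iW := ext_integrable oO c0 mk k0 gkx gky moo a0 dena.
have bW := ext_bound oO c0 mk k0 gkx gky moo a0 dena.
have mW := measurable_extE oO c0 mk k0 gkx gky.
have trC : 0 < 2 / a + 2 by rewrite addr_gt0// divr_gt0.
have cC : 0 < 1 + c by rewrite ltr_pwDl.
have lty_mul (b : R) (x : \bar R) : 0 < b -> (x < +oo)%E -> (b%:E * x < +oo)%E.
  by move=> b0 xoo; rewrite lte_mul_pinfty// lee_fin ltW.
split; [split|split|].
- split.
  + exact: (linear_subspaceV oO mk k0 gkx).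
  + exact: subW.
  + move=> u Vu; split; last first.
      by apply: le_lt_trans (trW _ Vu) _; apply: lty_mul => //; case: Vu.
    have [mu_ _] := Vu.
    apply: (measurable_funTS ((measurable_restrictT (u : lebesgueRn R d -> R) mG).1 _)).
    exact: measurable_funTS.
  + move=> u v _ _; apply: filterS => x uv Gx.
    by rewrite /Tr !patchE (mem_set Gx) uv//; right.
  + by move=> b u v _ _; apply: aeW => x Gx; rewrite /Tr !patchE (mem_set Gx).
(* [trW] compares squared norms; the norms themselves take the square root of its constant. *)
- exists (Num.sqrt (2 / a + 2)); first by rewrite sqrtr_gt0.
  move=> u Vu; rewrite /normW /normV.
  have V0 : (0 <= sqnormV Omega gamma u)%E.
    apply: adde_ge0; apply: integral_ge0 => x _; first by rewrite lee_fin sqr_ge0.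
    by apply: integral_ge0 => y _; rewrite lee_fin mulr_ge0// sqr_ge0.
  have CE : ((Num.sqrt (2 / a + 2))%:E * sqrte (sqnormV Omega gamma u) =
      sqrte ((2 / a + 2)%:E * sqnormV Omega gamma u))%E.
    by rewrite sqrteM// lee_fin ltW.
  by rewrite CE lee_sqrt ?trW// mule_ge0// lee_fin ltW.
- by move=> v Wv; exact: iW.
- split.
  + exact: subW.
  + split=> [|b u v [mu_ uoo] [mv voo]].
      split; first exact: measurable_cst.
      by rewrite /sqnormL2 integral0_eq ?ltry// => x _; rewrite expr0n.
    split; first exact: measurable_lincomb.
    (* Extension by zero outside Omega and the weight 1 bring the L^2 norm into the form of the
       lemma on linear combinations, which wants functions measurable everywhere. *)
    have lift (w : 'rV[R]_d -> R) : (sqnormL2 Omega w =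
        \int[lebesgue R d]_(x in Omega)
          (((w \_ Omega) x ^+ 2)%:E * cst 1 x))%E.
      by apply: eq_integral => x xO; rewrite mule1 patchE xO.
    rewrite lift in uoo; rewrite lift in voo; rewrite lift.
    have mO : measurable (Omega : set (lebesgueRn R d)).
      by apply: measurable_completion; exact: open_measurable_borelRn.
    have mOu := (measurable_restrictT (u : lebesgueRn R d -> R) mO).1 mu_.
    have mOv := (measurable_restrictT (v : lebesgueRn R d -> R) mO).1 mv.
    have := sqr_lincomb_integral_lty b mO mOu mOv (measurable_cst 1%E)
      (fun _ => lee01) uoo voo.
    apply: le_lt_trans; rewrite le_eqVlt; apply/orP; left; apply/eqP.
    by apply: eq_integral => x xO; rewrite !patchE xO.
  + move=> u Wu; split; first exact: mW.
    apply: (@le_lt_trans _ _ ((1 + c)%:E * sqnormW Omega gamma c u)%E).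
      apply: le_trans (bW _ Wu); rewrite leeDl// integral_ge0// => x _.
      by rewrite integral_ge0// => y _; rewrite lee_fin mulr_ge0// sqr_ge0.
    by apply: lty_mul => //; case: Wu.
  + move=> u v _ _ uv; apply: aeW => x _; apply: (f_equal fine).
    by apply: ae_eq_integral_lower; apply: filterS uv => y uv /uv ->.
  (* Linearity holds at every [x] where both integrands are integrable, that is, almost everywhere
     on Omega. *)
  + move=> b u v Wu Wv; apply: filterS2 (iW _ Wu) (iW _ Wv) => x iu iv Ox.
    rewrite /extE -RintegralZl ?(iu Ox)// -RintegralD//; first last.
    - exact: iv.
    - exact: integrableZl (iu Ox).
    apply: eq_Rintegral => y _; ring.
- by exists (1 + c); [exact: cC|exact: bW].
move=> [C C0 HC] u Wu; apply: (Tr_surjective oO g0 c0 mk k0 gkx gky moo a0 dena) => //.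
by apply: le_lt_trans (HC _ Wu) _; apply: lty_mul => //; case: Wu.
Qed.
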